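(* Let $d\ge2$ be an integer and $\sigma>0$. Let $r$ and $R$ be any two positive real numbers satisfying $R/r\ge2\sqrt d$. For each $\tau\in(0,1)$, there exist positive constants $c$ and $C$ depending only on $d,\sigma,\tau,r$ and $R$ such that, for all integers $n\ge2$, $$\inf_{\hat G_n}\sup_{G\in\mathcal{K}_{r,R}}\mathbb{P}_G\big[\mathsf{d}_{\mathsf H}(G,\hat G_n)>c(\ln n)^{-2/\tau}\big]\ge C$$ and $$\inf_{\hat G_n}\sup_{G\in\mathcal{K}_{r,R}}\mathbb{E}_G\big[\mathsf{d}_{\mathsf H}(G,\hat G_n)\big]\ge C(\ln n)^{-2/\tau},$$ where the infimum runs over all estimators $\hat G_n$ of $G$ based on $Y_1,\ldots,Y_n$.
   Context: A convex body is a convex compact subset of $\mathbb{R}^d$ with nonempty interior; $B_d(a,\rho)$ is the Euclidean ball with center $a$ and radius $\rho$. $\mathcal{K}_{r,R}$ is the collection of all convex bodies $G\subseteq\mathbb{R}^d$ such that $B_d(a,r)\subseteq G\subseteq B_d(0,R)$ for some $a\in\mathbb{R}^d$. Model: $Y_j=X_j+\varepsilon_j$, $j=1,\ldots,n$, where $X_1,\ldots,X_n$ are i.i.d. uniform in the convex body $G$ and $\varepsilon_1,\ldots,\varepsilon_n$ are i.i.d. $d$-dimensional centered Gaussian vectors with covariance matrix $\sigma^2I$, independent of the $X_j$'s; $\sigma^2$ is known. $\mathbb{P}_G$ is the joint distribution of $Y_1,\ldots,Y_n$ and $\mathbb{E}_G$ the corresponding expectation. The Hausdorff distance is $\mathsf{d}_{\mathsf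 H}(A,B)=\inf\{\epsilon>0: A\subseteq B+\epsilon B_d(0,1)\text{ and }B\subseteq A+\epsilon B_d(0,1)\}$. *)

(* Defs.v *)
From HB Require Import structures.
From mathcomp Require Import all_boot all_order all_algebra.
From mathcomp Require Import all_classical all_reals all_analysis measurable_realfun.
From mathcomp Require Import ring lra.

Set Implicit Arguments.
Unset Strict Implicit.
Unset Printing Implicit Defensive.

Import Order.TTheory GRing.Theory Num.Theory.
Import numFieldNormedType.Exports.

Local Open Scope classical_set_scope.
Local Open Scope ring_scope.

Section tuple_measure.
Context d (T : measurableType d) (R : realType).
Local Open Scope ereal_scope.

Definition tuple_cons n (x : T * n.-tuple T) : n.+1.-tuple T :=
  [tuple of x.1 :: x.2].

Let measurable_tuple_cons n : measurable_fun setT (@tuple_cons n).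
Proof. exact: measurable_cons. Qed.

HB.instance Definition _ n :=
  isMeasurableFun.Build _ _ _ _ (@tuple_cons n) (@measurable_tuple_cons n).

Section cons_measure.
Variables (n : nat) (m : {sigma_finite_measure set T -> \bar R}).
Variable (p : {sigma_finite_measure set (n.-tuple T) -> \bar R}).

Definition cons_measure : set (n.+1.-tuple T) -> \bar R :=
  pushforward (m \x p) (@tuple_cons n).

Let cons_measure0 : cons_measure set0 = 0.
Proof. exact: measure0. Qed.

Let cons_measure_ge0 A : 0 <= cons_measure A.
Proof. exact: measure_ge0. Qed.

Let cons_measure_semi_sigma_additive : semi_sigma_additive cons_measure.
Proof. exact: measure_semi_sigma_additive. Qed.

HB.instance Definition _ := isMeasure.Build _ _ _ cons_measure
  cons_measure0 cons_measure_ge0 cons_measure_semi_sigma_additive.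

Let cons_measure_sigma_finite : sigma_finite setT cons_measure.
Proof.
have /sigma_finiteP[F [TF ndF Foo]] := sigma_finiteT m.
have /sigma_finiteP[G [TG ndG Goo]] := sigma_finiteT p.
pose g (t : n.+1.-tuple T) := (thead t, [tuple of behead t]).
have mg : measurable_fun setT g.
  apply: measurable_fun_pair; first exact: measurable_tnth.
  exact: measurable_behead.
have gK : cancel (@tuple_cons n) g.
  by move=> [x t]; rewrite /g /tuple_cons theadE; congr (_, _); exact: val_inj.
exists (fun k => g @^-1` (F k `*` G k)).
  apply/seteqP; split => // t _.
  have [i _ Fi] : (\bigcup_i F i) (g t).1 by rewrite -TF.
  have [j _ Gj] : (\bigcup_i G i) (g t).2 by rewrite -TG.
  exists (maxn i j) => //; split.
  - by move: Fi; apply/subsetPset/ndF/leq_maxl.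
  - by move: Gj; apply/subsetPset/ndG/leq_maxr.
move=> k; have [mF Fk] := Foo k; have [mG Gk] := Goo k; split.
  by rewrite -[X in measurable X]setTI; apply: mg => //; exact: measurableX.
rewrite /cons_measure /pushforward -comp_preimage.
rewrite (_ : g \o _ = id) ?preimage_id; last by apply/funext => x /=; exact: gK.
by rewrite product_measure1E// lte_mul_pinfty// ge0_fin_numE.
Qed.

HB.instance Definition _ := Measure_isSigmaFinite.Build _ _ _ cons_measure
  cons_measure_sigma_finite.
End cons_measure.

(* The n-fold product of m; tuple_measure_box gives its value on boxes. *)
Fixpoint tuple_measure (m : {sigma_finite_measure set T -> \bar R}) (n : nat) :
    {sigma_finite_measure set (n.-tuple T) -> \bar R} :=
  if n is n'.+1 then cons_measure m (tuple_measure m n')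
  else \d_([tuple] : 0.-tuple T).

Lemma tuple_measure_box (m : {sigma_finite_measure set T -> \bar R}) n
    (A : 'I_n -> set T) : (forall i, measurable (A i)) ->
  tuple_measure m n [set t | forall i, A i (tnth t i)] = \prod_(i < n) m (A i).
Proof.
elim: n A => [|n IHn] A mA /=.
  by rewrite big_ord0 /dirac/= indicE mem_set// => -[].
rewrite big_ord_recl -IHn//.
rewrite -product_measure1E//; last first.
  rewrite (_ : [set _ | _] = \bigcap_(i in [set: 'I_n])
     (fun t => tnth t i) @^-1` (A (lift ord0 i))); last first.
    by apply/seteqP; split => t/= h i; [move=> _; exact: h|exact: h].
  apply: fin_bigcap_measurable => //= i _; rewrite -[X in measurable X]setTI.
  exact: measurable_tnth.
rewrite /cons_measure /pushforward; congr (_ _).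
apply/seteqP; split => -[x t] /=.
- move=> h; split; first exact: (h ord0).
  by move=> i; have := h (lift ord0 i); rewrite tnthS.
- move=> [Ax At] i; case: (unliftP ord0 i) => [j ->|->]; last by [].
  by rewrite tnthS; exact: At.
Qed.

End tuple_measure.

Section iid.
Context d (T : measurableType d) (R : realType) (P : probability T R) (n : nat).
Local Open Scope ereal_scope.

Definition iid : set (n.-tuple T) -> \bar R := tuple_measure P n.

HB.instance Definition _ := SigmaFiniteMeasure.on iid.

Let iid_setT : iid setT = 1.
Proof.
have := @tuple_measure_box _ _ R P n (fun=> setT) (fun=> measurableT).
rewrite big1 => [<-|i _]; last exact: probability_setT.
by congr (tuple_measure _ _ _); apply/seteqP; split.
Qed.

HB.instance Definition _ := Measure_isProbability.Build _ _ _ iid iid_setT.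

End iid.
Arguments iid {d T R} P n _.

Section euclidean_space.
Context (R : realType) (d : nat).
Local Notation V := 'rV[R]_d.

(* The library norm on 'rV[R]_d is the sup norm; it induces the same topology,
   but balls and distances must be taken in the Euclidean norm. *)
Definition enorm (x : V) : R := Num.sqrt (\sum_(i < d) x ord0 i ^+ 2).

Definition eball (a : V) (rho : R) : set V := [set x | enorm (x - a) <= rho].

Let coord (i : 'I_d) (x : V) : R := x ord0 i.

(* The product sigma-algebra, i.e. the Borel sigma-algebra: see
   open_measurable_rV below. *)
Let rV_measurable : set (set V) := g_sigma_preimage coord.

Let rV_measurable0 : rV_measurable set0.
Proof. exact: sigma_algebra0. Qed.

Let rV_measurableC A : rV_measurable A -> rV_measurable (~` A).
Proof. exact: sigma_algebraC. Qed.

Let rV_measurable_bigcup (F : (set V)^nat) : (forall i, rV_measurable (F i)) ->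
  rV_measurable (\bigcup_i F i).
Proof. exact: sigma_algebra_bigcup. Qed.

HB.instance Definition _ := @isMeasurable.Build
  (measure_tuple_display default_measure_display) V
  rV_measurable rV_measurable0 rV_measurableC rV_measurable_bigcup.

Lemma measurable_coord i : measurable_fun [set: V] (fun x : V => x ord0 i).
Proof.
move=> _ Y mY; rewrite setTI; apply: sub_sigma_algebra => /=.
rewrite -bigcup_seq/=; exists i => /=; first by rewrite mem_index_enum.
by exists Y => //; rewrite setTI.
Qed.

End euclidean_space.

Section rV_measure.
Context (R : realType) (d : nat).
Local Notation V := 'rV[R]_d.

Lemma measurable_rV_boxes (A : 'I_d -> set R) : (forall i, measurable (A i)) ->
  measurable [set v : V | forall i, A i (v ord0 i)].
Proof.
move=> mA; rewrite (_ : [set _ | _] = \bigcap_(i in [set: 'I_d])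
    (fun v : V => v ord0 i) @^-1` (A i)); last first.
  by apply/seteqP; split => t/= h i; [move=> _; exact: h|exact: h].
apply: fin_bigcap_measurable => //= i _; rewrite -[X in measurable X]setTI.
exact: measurable_coord.
Qed.

Lemma open_measurable_rV (U : set V) : open U -> measurable U.
Proof.
move=> oU.
pose B (q : {ffun 'I_d -> rat * rat}) i : set R :=
  `]ratr (q i).1, ratr (q i).2[%classic.
pose box q := [set v : V | forall i, B q i (v ord0 i)].
have -> : U = \bigcup_(q : {ffun 'I_d -> rat * rat})
    if `[< box q `<=` U >] then box q else set0.
  apply/seteqP; split=> [v Uv|v [q _]]; last by case: asboolP => // bU /bU.
  have /nbhs_ballP[e /= e0 eU] : nbhs v U by exact: open_nbhs_nbhs.
  have /choice[q qP] (i : 'I_d) : exists q : rat * rat,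
      [/\ v ord0 i - e < ratr q.1, ratr q.1 < v ord0 i,
          v ord0 i < ratr q.2 & ratr q.2 < v ord0 i + e].
    have := @rat_in_itvoo R (v ord0 i - e) (v ord0 i).
    rewrite ltrBlDr ltrDl => /(_ e0)[q1 /itvP q1P].
    have := @rat_in_itvoo R (v ord0 i) (v ord0 i + e).
    rewrite ltrDl => /(_ e0)[q2 /itvP q2P].
    by exists (q1, q2); rewrite /= !q1P !q2P.
  have vq : box [ffun i => q i] v.
    by move=> i; rewrite /B/= ffunE in_itv/=; have [_ -> -> _] := qP i.
  exists [ffun i => q i] => //; case: asboolP => // -[] w wq.
  apply: eU; split=> // i j.
  rewrite ord1 -ball_normE/=.
  have := wq j; rewrite /B/= ffunE in_itv/= => /andP[lt1 lt2].
  have [h1 h2 h3 h4] := qP j.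
  by rewrite ltr_distlC (lt_trans h1)//= (lt_trans lt2).
apply: countable_bigcupT_measurable => // q; case: ifPn => // _.
by apply: measurable_rV_boxes => i; exact: measurable_itv.
Qed.

Definition rV_of_tuple (t : d.-tuple (measurableTypeR R)) : V :=
  \row_(i < d) tnth t i.

Lemma measurable_fun_rV dT (T : measurableType dT) (f : T -> V) :
  (forall i, measurable_fun setT (fun t => f t ord0 i : R)) ->
  measurable_fun setT f.
Proof.
move=> mf; apply: (@measurability _ _ _ _ _ _
  (\big[setU/set0]_(i < d)
     preimage_set_system setT (fun v : V => v ord0 i) measurable)) => //.
move=> _ [B + <-]; rewrite -bigcup_seq/= => -[i _ [C mC <-]].
by rewrite setTI; exact: mf.
Qed.

Let measurable_rV_of_tuple : measurable_fun setT rV_of_tuple.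
Proof.
apply: measurable_fun_rV => i.
under eq_fun do rewrite mxE.
exact: measurable_tnth.
Qed.

HB.instance Definition _ :=
  isMeasurableFun.Build _ _ _ _ rV_of_tuple measurable_rV_of_tuple.

Definition lebesgue_rV : set V -> \bar R :=
  pushforward (tuple_measure (@lebesgue_measure R) d) rV_of_tuple.

Let lebesgue_rV0 : lebesgue_rV set0 = 0%E.
Proof. exact: measure0. Qed.

Let lebesgue_rV_ge0 A : (0 <= lebesgue_rV A)%E.
Proof. exact: measure_ge0. Qed.

Let lebesgue_rV_semi_sigma_additive : semi_sigma_additive lebesgue_rV.
Proof. exact: measure_semi_sigma_additive. Qed.

HB.instance Definition _ := isMeasure.Build _ _ _ lebesgue_rV
  lebesgue_rV0 lebesgue_rV_ge0 lebesgue_rV_semi_sigma_additive.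

Lemma lebesgue_rV_box (A : 'I_d -> set R) : (forall i, measurable (A i)) ->
  (lebesgue_rV [set v : V | forall i, A i (v ord0 i)] =
   \prod_(i < d) lebesgue_measure (A i))%E.
Proof.
move=> mA; rewrite -tuple_measure_box//; congr (tuple_measure _ _ _).
by apply/seteqP; split => t /= At i; have := At i; rewrite mxE.
Qed.

(* The centered Gaussian law with covariance sigma^2 I: independent N(0, sigma^2)
   coordinates. The second argument of normal_prob is the standard deviation. *)
Definition gaussian_rV (sigma : R) : set V -> \bar R :=
  distribution (iid (normal_prob (0 : R) sigma) d) rV_of_tuple.

HB.instance Definition _ sigma := Probability.on (gaussian_rV sigma).

End rV_measure.

Section convex_body.
Context (R : realType) (d : nat).
Local Notation V := 'rV[R]_d.

Record convex_body := ConvexBody {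
  body :> set V ;
  body_convex : convex_set (body : set (convex_lmodType V)) ;
  body_compact : compact body ;
  body_interior : body° !=set0 }.

Lemma measurable_body (G : convex_body) : measurable (body G).
Proof.
rewrite -[body G]setCK; apply: measurableC; apply: open_measurable_rV.
apply: closed_openC; apply: compact_closed; last exact: body_compact.
exact: norm_hausdorff.
Qed.

Lemma lebesgue_body_gt0 (G : convex_body) : (0 < lebesgue_rV G)%E.
Proof.
have [a /nbhs_ballP[e /= e0 eG]] := body_interior G.
pose A i := `](a ord0 i - e), (a ord0 i + e)[%classic.
apply: (@lt_le_trans _ _ (lebesgue_rV [set v : V | forall i, A i (v ord0 i)])).
  rewrite lebesgue_rV_box; last by move=> i; exact: measurable_itv.
  rewrite (eq_bigr (fun=> (e *+ 2)%:E)) => [|i _].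
    by rewrite prodEFin lte_fin; apply: prodr_gt0 => i _; rewrite mulrn_wgt0.
  rewrite /A lebesgue_measure_itv/= lte_fin ltrBlDr -addrA ltrDl addr_gt0//.
  by rewrite -EFinD; congr EFin; ring.
apply: le_measure; rewrite ?inE; [|exact: measurable_body|].
  by apply: measurable_rV_boxes => i; exact: measurable_itv.
move=> v Av; apply: eG; split=> // i j.
by rewrite ord1 -ball_normE/= ltr_distlC; have := Av j; rewrite /A/= in_itv.
Qed.

Lemma lebesgue_body_lty (G : convex_body) : (lebesgue_rV G < +oo)%E.
Proof.
have [M [Mreal GM]] := compact_bounded (@body_compact G).
pose N := `|M| + 1.
pose A (i : 'I_d) := `[(- N), N]%classic.
apply: (@le_lt_trans _ _ (lebesgue_rV [set v : V | forall i, A i (v ord0 i)])).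
  apply: le_measure; rewrite ?inE; [exact: measurable_body| |].
    by apply: measurable_rV_boxes => i; exact: measurable_itv.
  move=> v Gv i; rewrite /A/= in_itv/= -ler_norml.
  have MN : M < N by rewrite /N (le_lt_trans (ler_norm _))// ltrDl.
  apply: le_trans (GM _ MN _ Gv).
  have /mapP[j Hj ->] : `|v ord0 i| \in [seq `|v x.1 x.2| | x : 'I_1 * 'I_d].
    by apply/mapP; exists (ord0, i) => //=; rewrite mem_enum.
  by rewrite [leRHS]/Num.norm /= mx_normrE; apply/bigmax_geP; right => /=; exists j.
rewrite lebesgue_rV_box; last by move=> i; exact: measurable_itv.
rewrite ltey_eq prode_fin_num// => i _.
by rewrite /A lebesgue_measure_itv/=; case: ifP.
Qed.

End convex_body.

Section uniform_body.
Context (R : realType) (d : nat) (G : convex_body R d).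
Local Notation V := 'rV[R]_d.
Local Open Scope ereal_scope.

Definition uniform_body (A : set V) : \bar R :=
  lebesgue_rV (A `&` G) * (fine (lebesgue_rV G))^-1%:E.

Let uniform_bodyE : uniform_body =
  mnormalize (mrestr (@lebesgue_rV R d) (measurable_body G)) (dirac point).
Proof.
have G0 := lebesgue_body_gt0 G; have Goo := lebesgue_body_lty G.
have GT : mrestr (@lebesgue_rV R d) (measurable_body G) setT = lebesgue_rV G.
  by rewrite /mrestr setTI.
by rewrite /mnormalize/= GT ifF// gt_eqF//= lt_eqF.
Qed.

Let uniform_body0 : uniform_body set0 = 0.
Proof. by rewrite uniform_bodyE measure0. Qed.

Let uniform_body_ge0 A : 0 <= uniform_body A.
Proof. by rewrite uniform_bodyE measure_ge0. Qed.

Let uniform_body_semi_sigma_additive : semi_sigma_additive uniform_body.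
Proof. by rewrite uniform_bodyE; exact: measure_semi_sigma_additive. Qed.

HB.instance Definition _ := isMeasure.Build _ _ _ uniform_body
  uniform_body0 uniform_body_ge0 uniform_body_semi_sigma_additive.

Let uniform_body_setT : uniform_body setT = 1.
Proof. by rewrite uniform_bodyE probability_setT. Qed.

HB.instance Definition _ := Measure_isProbability.Build _ _ _ uniform_body
  uniform_body_setT.

End uniform_body.

Section model.
Context (R : realType) (d : nat).
Local Notation V := 'rV[R]_d.

Definition observation n (xe : n.-tuple V * n.-tuple V) : n.-tuple V :=
  [tuple tnth xe.1 j + tnth xe.2 j | j < n].

Let measurable_observation n : measurable_fun setT (@observation n).
Proof.
apply/measurable_fun_tnthP => j; apply: measurable_fun_rV => i.
rewrite [X in measurable_fun _ X](_ : _ =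
    fun xe : n.-tuple V * n.-tuple V =>
      tnth xe.1 j ord0 i + tnth xe.2 j ord0 i); last first.
  by apply/funext => xe /=; rewrite tnth_mktuple mxE.
have mtj : measurable_fun setT (fun x : n.-tuple V => tnth x j ord0 i : R).
  by apply: (measurableT_comp (measurable_coord i)); exact: measurable_tnth.
by apply: measurable_funD; apply: (measurableT_comp mtj).
Qed.

HB.instance Definition _ n := isMeasurableFun.Build _ _ _ _ (@observation n)
  (@measurable_observation n).

(* The joint law of the Y_j = X_j + eps_j, where the X_j are i.i.d. uniform in G,
   the eps_j are i.i.d. Gaussian, and the two samples are independent. *)
Definition observation_law (sigma : R) n (G : convex_body R d) :
    set (n.-tuple V) -> \bar R :=
  distribution (iid (uniform_body G) n \x iid (@gaussian_rV R d sigma) n)%E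
    (@observation n).

HB.instance Definition _ sigma n G :=
  Probability.on (@observation_law sigma n G).

(* Infinite when one of the sets is empty and the other is not, or when no
   bounded enlargement of one set contains the other. *)
Definition hausdorff_dist (A B : set V) : \bar R :=
  ereal_inf [set e%:E | e in [set e : R | [/\ 0 < e,
    A `<=` [set b + e *: u | b in B & u in eball 0 1] &
    B `<=` [set a + e *: u | a in A & u in eball 0 1]]]].

Definition bodies_between (r rho : R) : set (convex_body R d) :=
  [set G | (exists a, eball a r `<=` G) /\ G `<=` eball 0 rho].

(* An estimator is an arbitrary set-valued function of the observations; the
   only regularity required is that its loss is a random variable for every
   body of the class, so that the risks below make sense. *)
Definition estimators (K : set (convex_body R d)) n :
    set (n.-tuple V -> set V) :=
  [set Ghat : n.-tuple V -> set V | forall G, K G ->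
    measurable_fun setT (fun y : n.-tuple V => hausdorff_dist G (Ghat y))].

End model.
Arguments observation_law {R d} sigma n G _.
Arguments estimators {R d} K n _.

(* Main.v *)
From HB Require Import structures.
Require Import Defs.
From mathcomp Require Import all_boot all_order all_algebra.
From mathcomp Require Import all_classical all_reals all_analysis measurable_realfun.
From mathcomp Require Import ring lra zify.

(** Le Cam's method with two hypotheses. Let P be a regular polygon with K sides
    and inradius r, let P' be its rotation by pi / K, and let G1 and G2 be the
    products of P and P' with the cube [-r, r]^(d - 2) in the other coordinates.

    Separation. Some vertex of P lies at distance r / cos (pi / K) from the centre
    in a direction normal to a side of P', hence at distance at least
    r (1 - cos (pi / K)) from G2 ([prism_vertex]). This is of order K^-2
    ([onem_cos_lower]), and no set can be much closer than that to both bodies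
    ([hausdorff_two_point]).

    Indistinguishability. By the Cameron-Martin formula
    ([ge0_integral_gaussian_translation]), the law of one observation has, with
    respect to the law of the noise, the density at z equal to the mean over x
    in G of exp ((<x, z> - |x|^2 / 2) / sigma^2). Lebesgue measure is invariant
    under rotations of the plane of P ([lebesgue_rV_rotation]), the rotations by
    even multiples of pi / K preserve G1 and those by odd multiples map it onto
    G2. The difference of the two densities is thus the mean over x in G1 of an
    alternating sum over the 2K rotations of x by multiples of pi / K, divided
    by K. Along these rotations |x| is constant and <x, z> is, up to a constant,
    a trigonometric polynomial of degree one in the angle, so that the alternating
    sums of its powers below K vanish: in the expansion of the exponential only
    the remainder of order K survives ([alternating_sum_expR]). It is at most
    e^-K times an exponential of |z|, which has a finite Gaussian integral, and
    the laws of one observation differ by at most C e^-K in total variation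
    ([one_observation_comparison]). Replacing the observations one by one, the
    laws of the samples differ by at most n C e^-K ([observation_tensorization]).

    With K equal to ln n up to a constant factor and large enough, this bound is
    at most 1 / 2, and one of the two bodies is missed with probability at least
    1 / 4 ([le_cam_two_point]). The bodies are then separated at the rate
    (ln n)^-2, which exceeds (ln n)^(-2 / tau) up to a constant because tau < 1
    ([powR_log_rate]). *)

Set Implicit Arguments.
Unset Strict Implicit.
Unset Printing Implicit Defensive.

Import Order.TTheory GRing.Theory Num.Theory.
Import numFieldNormedType.Exports.

Local Open Scope classical_set_scope.
Local Open Scope ring_scope.

(** * Alternating trigonometric sums *)

Section trig.
Context {R : realType}.
Implicit Types (a b t x eta psi M T : R) (K m : nat).

Lemma cosM_cos a b : cos a * cos b = (cos (b + a) + cos (b - a)) / 2.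
Proof. by rewrite cosD cosB; field. Qed.

Lemma sinM_cos a b :
  sin a * cos b = (cos (b + a - pi / 2) - cos (b - a - pi / 2)) / 2.
Proof. by rewrite !cosBpihalf sinD sinB; field. Qed.

(** The factor 2 sin (eta / 2) makes the sum telescope. *)
Lemma sum_cos_progression eta psi m :
  2 * sin (eta / 2) * (\sum_(l < m) cos (psi + l%:R * eta)) =
  sin (psi + m%:R * eta - eta / 2) - sin (psi - eta / 2).
Proof.
elim: m => [|m IHm]; first by rewrite big_ord0 mulr0 mul0r addr0 subrr.
rewrite big_ord_recr/= mulrDr IHm.
have -> : psi + m.+1%:R * eta - eta / 2 = psi + m%:R * eta + eta / 2.
  by rewrite -addn1 natrD; field.
by rewrite !sinB !sinD; ring.
Qed.

Lemma cos_alternating x l : (-1) ^+ l * cos x = cos (x + l%:R * pi).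
Proof.
elim: l => [|l IHl]; first by rewrite mul0r addr0 mul1r.
rewrite exprS -mulrA IHl mulN1r -natr1 mulrDl mul1r addrA.
by rewrite [RHS]cosDpi.
Qed.

(** With the signs absorbed in the angles, these are in arithmetic progression
    with step eta = (q + K) pi / K. After 2K steps the angle has advanced by a
    multiple of 2 pi, so that the telescoped sum vanishes, and |q| < K places
    eta / 2 strictly between 0 and pi, where the sine is not zero. *)
Lemma alternating_sum_cos K (q : int) psi : (`|q| < K)%N ->
  \sum_(l < K.*2) (-1) ^+ l * cos (q%:~R * (l%:R * (pi / K%:R)) + psi) = 0.
Proof.
move=> qK; have K0 : K%:R != 0 :> R by rewrite pnatr_eq0; lia.
pose eta : R := (q%:~R + K%:R) * (pi / K%:R).
have sin_gt0 : 0 < sin (eta / 2).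
  have [q1 q2] : (0 < q%:~R + K%:R :> R) /\ (q%:~R + K%:R < K%:R + K%:R :> R).
    by rewrite !pmulrn -!intrD ltr_int ltr0z; split; lia.
  apply: sin_gt0_pi; have pi0 := @pi_gt0 R.
  have Kgt0 : 0 < K%:R :> R by rewrite ltr0n; lia.
  rewrite /eta; apply/andP; split.
    by apply: divr_gt0 => //; apply: mulr_gt0 => //; exact: divr_gt0.
  by rewrite ltr_pdivrMr // mulrA ltr_pdivrMr //; nra.
apply: (mulfI (lt0r_neq0 (mulr_gt0 (ltr0n _ 2) sin_gt0))).
rewrite mulr0 -[RHS](subrr (sin (psi - eta / 2))).
transitivity (2 * sin (eta / 2) *
    (\sum_(l < K.*2) cos (psi + l%:R * eta))).
  congr (_ * _); apply: eq_bigr => l _; rewrite cos_alternating /eta.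
  by congr cos; field.
rewrite sum_cos_progression; congr (_ - _).
have -> : psi + K.*2%:R * eta - eta / 2 =
    psi - eta / 2 + (pi *+ 2) *+ absz (q + K%:Z).
  rewrite -(mulr_natl _ (absz (q + K%:Z))) natr_absz ger0_norm; last by lia.
  rewrite intrD -pmulrn /eta -mul2n natrM -(mulr_natl pi 2); by field.
by rewrite periodicn//; exact: sinD2pi.
Qed.

(** By the product-to-sum formulas, removing one factor of the power moves the
    frequency q by one: |q| + m does not grow, and the induction on m ends with
    [alternating_sum_cos]. *)
Lemma alternating_sum_trigX K m (q : int) a b psi : (`|q| + m < K)%N ->
  \sum_(l < K.*2) (-1) ^+ l *
     ((a * cos (l%:R * (pi / K%:R)) + b * sin (l%:R * (pi / K%:R))) ^+ m *
      cos (q%:~R * (l%:R * (pi / K%:R)) + psi)) = 0.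
Proof.
elim: m q psi => [|m IHm] q psi qmK.
  rewrite addn0 in qmK; rewrite -[RHS](alternating_sum_cos psi qmK).
  by apply: eq_bigr => l _; rewrite mul1r.
pose S (k : int) phi := \sum_(l < K.*2) (-1) ^+ l *
     ((a * cos (l%:R * (pi / K%:R)) + b * sin (l%:R * (pi / K%:R))) ^+ m *
      cos (k%:~R * (l%:R * (pi / K%:R)) + phi)) : R.
have S0 k phi : (`|k| + m < K)%N -> S k phi = 0 by exact: IHm.
transitivity (a / 2 * (S (q + 1) psi + S (q - 1) psi) +
    b / 2 * (S (q + 1) (psi - pi / 2) - S (q - 1) (psi - pi / 2))); last first.
  by rewrite !S0 ?(subrr, addr0, mulr0)//; lia.
rewrite /S -sumrN -!big_split/= !mulr_sumr -big_split/=.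
apply: eq_bigr => l _.
set al := l%:R * _; rewrite intrD intrB.
have -> : (q%:~R + 1%:~R) * al + psi = q%:~R * al + psi + al by ring.
have -> : (q%:~R - 1%:~R) * al + psi = q%:~R * al + psi - al by ring.
have -> : (q%:~R + 1%:~R) * al + (psi - pi / 2) = q%:~R * al + psi + al - pi / 2 by ring.
have -> : (q%:~R - 1%:~R) * al + (psi - pi / 2) = q%:~R * al + psi - al - pi / 2 by ring.
set be := q%:~R * al + psi; set X := _ ^+ m.
transitivity ((-1) ^+ l *
    (X * (a * (cos al * cos be) + b * (sin al * cos be)))).
  by rewrite exprSr -/X; ring.
by rewrite cosM_cos sinM_cos; field.
Qed.

(** For j >= m, the term |t|^j / j! is at most M^-m (M |t|)^j / j!. This form of the
    remainder, with a free parameter M, gives geometric decay in m and remains an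
    exponential in t, which is integrable against a Gaussian law. *)
Lemma expR_taylor_bound M t m : 1 <= M ->
  `|expR t - \sum_(j < m) t ^+ j / j`!%:R| <= M ^- m * expR (M * `|t|).
Proof.
move=> M1; have M0 : 0 < M by exact: lt_le_trans M1.
have cvgE : series (exp_coeff t) @ \oo --> expR t by exact: is_cvg_series_exp_coeff.
have : (fun n => `|series (exp_coeff t) n - \sum_(j < m) t ^+ j / j`!%:R|) @ \oo
    --> `|expR t - \sum_(j < m) t ^+ j / j`!%:R|.
  apply: cvg_norm; apply: cvgB => //; exact: cvg_cst.
move/(@cvg_lim R) => <-//; apply: limr_le.
  apply/cvg_ex; eexists; apply: cvg_norm; apply: cvgB; [exact: cvgE|exact: cvg_cst].
near=> n; have mn : (m <= n)%N by near: n; exact: nbhs_infty_ge.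
rewrite -(big_mkord xpredT (fun j => t ^+ j / j`!%:R)) /series/=.
rewrite (big_cat_nat (n := m))//= addrAC subrr add0r.
apply: (le_trans (ler_norm_sum _ _ _)).
apply: (@le_trans _ _ (\sum_(m <= j < n) M ^- m * exp_coeff (M * `|t|) j)).
  apply: ler_sum_nat => j /andP[mj _].
  rewrite /exp_coeff/= normrM normrX normfV (ger0_norm (ler0n _ _)) exprMn.
  rewrite mulrA ler_wpM2r ?invr_ge0// mulrA ler_peMl ?exprn_ge0//.
  by rewrite mulrC ler_pdivlMr ?exprn_gt0// mul1r ler_weXn2l.
rewrite -mulr_sumr ler_wpM2l ?invr_ge0 ?exprn_ge0 ?(ltW M0)//.
have ec0 k : 0 <= exp_coeff (M * `|t|) k.
  by apply: exp_coeff_ge0; rewrite mulr_ge0 // ltW.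
apply: (@le_trans _ _ (series (exp_coeff (M * `|t|)) n)).
  by rewrite /series/= [leRHS](big_cat_nat (n := m))//= lerDr sumr_ge0.
apply: nondecreasing_cvgn_le; last exact: is_cvg_series_exp_coeff.
by apply/nondecreasing_series => k _.
Unshelve. all: by end_near. Qed.

(** Taylor expansion: the powers below K disappear by [alternating_sum_trigX], and
    each of the 2K remainders is bounded by [expR_taylor_bound]. *)
Lemma alternating_sum_expR K a b M T : 1 <= M ->
  (forall l, `|a * cos (l%:R * (pi / K%:R)) + b * sin (l%:R * (pi / K%:R))|
     <= T) ->
  \sum_(l < K.*2) (-1) ^+ l *
    expR (a * cos (l%:R * (pi / K%:R)) + b * sin (l%:R * (pi / K%:R)))
  <= K.*2%:R * (M ^- K * expR (M * T)).
Proof.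
move=> M1 tT; have M0 : 0 < M by exact: lt_le_trans M1.
set t := fun l : nat => a * cos (l%:R * (pi / K%:R)) + b * sin (l%:R * (pi / K%:R)).
have poly0 : \sum_(l < K.*2) (-1) ^+ l * (\sum_(j < K) t l ^+ j / j`!%:R) = 0.
  under eq_bigr do rewrite mulr_sumr.
  rewrite exchange_big/= big1 // => j _.
  under eq_bigr do rewrite mulrA.
  rewrite -mulr_suml (_ : \sum_(_ < _) _ = 0) ?mul0r//.
  rewrite -[RHS](@alternating_sum_trigX K j 0 a b 0) ?absz0 ?add0n//.
  by apply: eq_bigr => l _; rewrite mul0r add0r cos0 mulr1.
rewrite -[leLHS]/(\sum_(l < K.*2) (-1) ^+ l * expR (t l)).
have -> : \sum_(l < K.*2) (-1) ^+ l * expR (t l) =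
    \sum_(l < K.*2) (-1) ^+ l * (expR (t l) - \sum_(j < K) t l ^+ j / j`!%:R).
  by under [RHS]eq_bigr do rewrite mulrBr; rewrite sumrB poly0 subr0.
apply: (le_trans (ler_norm _)); apply: (le_trans (ler_norm_sum _ _ _)).
apply: (@le_trans _ _ (\sum_(l < K.*2) (M ^- K * expR (M * T)))); last first.
  by rewrite sumr_const card_ord mulr_natl.
apply: ler_sum => l _; rewrite normrM normrX normrN1 expr1n mul1r.
apply: (le_trans (expR_taylor_bound _ _ M1)).
rewrite ler_wpM2l ?invr_ge0 ?exprn_ge0 ?(ltW M0)//.
by rewrite ler_expR ler_wpM2l ?(ltW M0)//; exact: tT.
Qed.
End trig.

(** * Elementary bounds on sine and cosine *)

Section trig_bounds.
Context {R : realType}.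

(** The mean value theorem, the slope of the sine being at least cos 1 on [0, 1]. *)
Lemma sin_ge_linear (x : R) : 0 <= x <= 1 -> cos 1 * x <= sin x.
Proof.
move=> /andP[x0 x1].
have [c] := @MVT_segment R sin cos 0 x x0 (fun y _ => is_derive_sin y)
  (continuous_subspaceT (@continuous_sin R)).
rewrite in_itv/= => /andP[c0 cx]; rewrite sin0 !subr0 => ->.
have pi2 := @pi_ge2 R.
rewrite ler_wpM2r// le_eqVlt; have [->|c1] := eqVneq c 1; first by rewrite eqxx.
have cpi : c \in `[0, pi] by rewrite in_itv/= c0/=; lra.
have pi1 : 1 \in `[0, pi : R] by rewrite in_itv/=; lra.
by rewrite (ltr_cos cpi pi1) lt_neqAle c1 (le_trans cx x1) orbT.
Qed.

(** Half-angle formula and [sin_ge_linear]. The value of the constant is immaterial;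
    the order K^-2 is what gives the rate of the theorem. *)
Lemma onem_cos_lower (K : nat) : (2 < K)%N ->
  2 * cos 1 ^+ 2 / K%:R ^+ 2 <= 1 - cos (pi / K%:R : R).
Proof.
move=> K2; have K0 : 0 < K%:R :> R by rewrite ltr0n; lia.
have K3 : 3 <= K%:R :> R by rewrite ler_nat.
pose y : R := pi / K%:R / 2.
have -> : pi / K%:R = y *+ 2 by rewrite /y mulr2n; field; rewrite gt_eqF.
have pi2 := @pi_ge2 R; have pi4 : pi < 4 :> R by have := @pihalf_lt2 R; lra.
have y0 : K%:R^-1 <= y.
  by rewrite /y mulrAC ler_peMl ?invr_ge0 ?(ltW K0)//; lra.
have y1 : y <= 1.
  by rewrite /y ler_pdivrMr// mul1r ler_pdivrMr//; lra.
have Kinv0 : 0 < K%:R^-1 :> R by rewrite invr_gt0.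
have c1 := @cos1_gt0 R.
have : cos 1 * K%:R^-1 <= sin y.
  apply: le_trans (sin_ge_linear _); last by rewrite y1 andbT; lra.
  by rewrite ler_pM2l.
move=> /(lerXn2r 2); rewrite !nnegrE => h.
have /h : 0 <= cos 1 * K%:R^-1 :> R by rewrite mulr_ge0 ?ltW.
have siny : 0 <= sin y.
  by apply: le_trans (sin_ge_linear _); [rewrite mulr_ge0//; lra|rewrite y1 andbT; lra].
move=> /(_ siny); rewrite cos_mulr2n exprMn exprVn sin2cos2; lra.
Qed.

(** The difference of the cosines is 2 sin (l h) sin ((l - 1) h) with h = pi / K.
    Two consecutive multiples of h lie in a common interval between multiples
    of pi, on which the sine keeps its sign. *)
Lemma cos_odd_le_cos (K : nat) (l : int) : (0 < K)%N ->
  cos ((2 * l%:~R - 1) * (pi / K%:R)) <= cos (pi / K%:R : R).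
Proof.
move=> K0; have KR : 0 < K%:R :> R by rewrite ltr0n.
set h := pi / K%:R; have h0 : 0 <= h by rewrite divr_ge0 ?pi_ge0.
rewrite -subr_ge0.
have -> : cos h - cos ((2 * l%:~R - 1) * h) =
    2 * (sin (l%:~R * h) * sin ((l%:~R - 1) * h)).
  have hE : cos h = cos (l%:~R * h - (l%:~R - 1) * h) by congr cos; ring.
  have -> : (2 * l%:~R - 1) * h = l%:~R * h + (l%:~R - 1) * h by ring.
  by rewrite hE cosB cosD; ring.
rewrite mulr_ge0//.
have sinDq (q : int) : exists2 e : R, e * e = 1 &
    forall x, sin (x + q%:~R * pi) = e * sin x.
  have P (n : nat) y : sin (y + n%:R * pi) = (-1) ^+ n * sin y :> R.
    elim: n y => [|n IHn] y; first by rewrite mul0r addr0 mul1r.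
    by rewrite -natr1 mulrDl mul1r addrA sinDpi IHn exprS; ring.
  have sq (n : nat) : (-1) ^+ n * (-1) ^+ n = 1 :> R by rewrite -expr2 sqrr_sign.
  case: q => n; first by exists ((-1) ^+ n) => // x; rewrite -P.
  exists ((-1) ^+ n.+1) => // x.
  have := P n.+1 (x + (Negz n)%:~R * pi).
  by rewrite NegzE mulrNz mulNr subrK => ->; rewrite mulrA sq mul1r.
have lE : l = (l %/ K)%Z * K%:Z + (l %% K)%Z by exact: divz_eq.
have m0 : 0 <= (l %% K)%Z by rewrite modz_ge0//; lia.
have mK : (l %% K)%Z < K%:Z by rewrite ltz_pmod.
move: m0 mK lE; set q := (l %/ K)%Z; set s := (l %% K)%Z => s0 sK lE.
(* shifting both angles by q pi multiplies the two sines by the same sign e *)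
have [e e2 se] := sinDq q.
have Kh : K%:R * h = pi by rewrite mulrC divfK// gt_eqF.
have -> : l%:~R * h = s%:~R * h + q%:~R * pi.
  by rewrite -Kh lE intrD intrM -pmulrn; ring.
have -> : (l%:~R - 1) * h = (s%:~R - 1) * h + q%:~R * pi.
  by rewrite -Kh lE intrD intrM -pmulrn; ring.
rewrite !se mulrACA e2 mul1r.
have [->|sN0] := eqVneq s 0; first by rewrite mul0r sin0 mul0r.
have s1 : 1 <= s%:~R :> R by rewrite (_ : 1 = 1%:~R)// ler_int; lia.
have sKR : s%:~R <= K%:R :> R by rewrite pmulrn ler_int; lia.
by apply: mulr_ge0; apply: sin_ge0_pi; rewrite -Kh; nra.
Qed.
End trig_bounds.

(** * Integrals against densities, translates and product measures *)

Section density.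
Local Open Scope ereal_scope.
Context d (T : measurableType d) (R : realType).
Import HBNNSimple.

(** Monotone convergence from simple functions. It applies both to the normal law
    and to the uniform law on a body, whose densities are explicit; going through
    Radon-Nikodym derivatives would only identify them almost everywhere. *)
Lemma ge0_integral_density (nu mu : {measure set T -> \bar R}) (p : T -> R)
    (f : T -> \bar R) :
  measurable_fun setT p -> (forall x, (0 <= p x)%R) ->
  (forall A, measurable A -> nu A = \int[mu]_(x in A) (p x)%:E) ->
  measurable_fun setT f -> (forall x, 0 <= f x) ->
  \int[nu]_x f x = \int[mu]_x (f x * (p x)%:E).
Proof.
move=> mp p0 nuE mf f0; pose h := nnsfun_approx measurableT mf.
have mEp : measurable_fun setT (EFin \o p) by exact/measurable_EFinP.
transitivity (limn (fun n => \int[nu]_x (h n x)%:E)).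
  rewrite -monotone_convergence//.
  - by apply: eq_integral => x _; apply/esym/cvg_lim => //;
      apply: cvg_nnsfun_approx.
  - by move=> n; exact/measurable_EFinP/measurable_funP.
  - by move=> n x _; rewrite lee_fin.
  - by move=> x _ m n mn; rewrite lee_fin; exact/lefP/nd_nnsfun_approx.
transitivity (limn (fun n => \int[mu]_x ((h n x)%:E * (p x)%:E))); last first.
  rewrite -monotone_convergence//.
  - apply: eq_integral => x _; apply/cvg_lim => //; apply: cvgeZr => //.
    exact: cvg_nnsfun_approx.
  - by move=> n; apply: emeasurable_funM => //;
      exact/measurable_EFinP/measurable_funP.
  - by move=> n x _; rewrite mule_ge0 ?lee_fin.
  - by move=> x _ m n mn; rewrite lee_wpmul2r ?lee_fin//;
      exact/lefP/nd_nnsfun_approx.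
congr (limn _); apply/funext => n.
have mindic r : measurable_fun setT (fun x => (r * \1_(h n @^-1` [set r]) x)%:E).
  by apply/measurable_EFinP; exact: measurable_funM.
transitivity (\int[nu]_x
   (\sum_(y \in range (h n)) (y * \1_(h n @^-1` [set y]) x)%:E)).
  by apply: eq_integral => x _; rewrite fimfunE -fsumEFin.
rewrite ge0_integral_fsum//; last by move=> m y Ey; exact: nnfun_muleindic_ge0.
transitivity (\int[mu]_x (\sum_(y \in range (h n))
    (y * \1_(h n @^-1` [set y]) x)%:E * (p x)%:E)); last first.
  apply: eq_integral => x _; rewrite -ge0_mule_fsuml => [|y].
    by rewrite fsumEFin // -(fimfunE _ x).
  exact: nnfun_muleindic_ge0.
rewrite ge0_integral_fsum//; last 2 first.
  - by move=> y; exact: emeasurable_funM.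
  - move=> m y Ey; apply: mule_ge0; last by rewrite lee_fin.
    exact: nnfun_muleindic_ge0.
apply: eq_fsbigr => r rhn.
under eq_integral do rewrite EFinM.
rewrite integralZl_indic_nnsfun => //.
under [RHS]eq_integral do rewrite EFinM -muleA.
rewrite [RHS]ge0_integralZl//.
- congr (_ * _); rewrite integral_indic// setIT nuE//.
  under [RHS]eq_integral do rewrite muleC.
  rewrite [RHS](eq_integral ((EFin \o p) \_ (h n @^-1` [set r]))); last first.
    by move=> x xE; rewrite epatch_indic.
  by rewrite -integral_mkcondr setTI.
- by apply: emeasurable_funM => //; exact/measurable_EFinP.
- by move=> t Et; rewrite mule_ge0 ?lee_fin.
- by move: rhn; rewrite inE => -[t _ <-]; rewrite lee_fin.
Qed.
End density.

Lemma ge0_le_integralT d (T : measurableType d) (R : realType)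
    (mu : {measure set T -> \bar R}) (f g : T -> \bar R) :
  measurable_fun setT f -> measurable_fun setT g ->
  (forall x, 0 <= f x)%E -> (forall x, f x <= g x)%E ->
  (\int[mu]_x f x <= \int[mu]_x g x)%E.
Proof. by move=> mf mg f0 fg; apply: ge0_le_integral. Qed.

Section translation.
Local Open Scope ereal_scope.
Context {R : realType}.
Local Notation mu := (@lebesgue_measure R).

Lemma lebesgue_measure_translation (a : R) (A : set (measurableTypeR R)) :
  measurable A ->
  pushforward mu (fun x : measurableTypeR R => (x + a)%R : measurableTypeR R) A
    = mu A.
Proof.
move=> mA.
have ma : measurable_fun setT (fun x : measurableTypeR R => (x + a)%R : measurableTypeR R).
  exact: measurable_funD.
pose sh : {mfun measurableTypeR R >-> measurableTypeR R} :=
  HB.pack (fun x : measurableTypeR R => (x + a)%R : measurableTypeR R)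
    (isMeasurableFun.Build _ _ _ _ _ ma).
apply/esym/(@lebesgue_measure_unique R (pushforward mu sh)) => //= _ [[b c]] _ <-.
rewrite /pushforward.
rewrite (_ : (_ @^-1` _) = `](b - a)%R, (c - a)%R]%classic); last first.
  by apply/seteqP; split=> x /=; rewrite !in_itv/= ltrBlDr lerBrDr.
rewrite !lebesgue_measure_itv/= !lte_fin ltrD2r; case: ifPn => // _.
by rewrite -!EFinB; congr EFin; ring.
Qed.

Lemma ge0_integral_translation (a : R) (f : measurableTypeR R -> \bar R) :
  measurable_fun setT f -> (forall x, 0 <= f x) ->
  \int[mu]_x f (x + a)%R = \int[mu]_x f x.
Proof.
move=> mf f0.
have ma : measurable_fun setT (fun x : measurableTypeR R => (x + a)%R : measurableTypeR R).
  exact: measurable_funD.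
transitivity (\int[pushforward mu
   (fun x : measurableTypeR R => (x + a)%R : measurableTypeR R)]_x f x).
  by rewrite (ge0_integral_pushforward ma).
by apply: eq_measure_integral => A mA _; exact: lebesgue_measure_translation.
Qed.
End translation.

Section tuple_integral.
Local Open Scope ereal_scope.
Context d (T : measurableType d) (R : realType).

Lemma ge0_integral_tuple_measure0 (m : {sigma_finite_measure set T -> \bar R})
    (f : 0.-tuple T -> \bar R) : measurable_fun setT f ->
  \int[tuple_measure m 0]_t f t = f [tuple].
Proof.
by move=> mf; rewrite /= integral_dirac//= diracE mem_set// mul1e.
Qed.

Lemma ge0_integral_tuple_measureS (m : {sigma_finite_measure set T -> \bar R})
    n (f : n.+1.-tuple T -> \bar R) :
  measurable_fun setT f -> (forall x, 0 <= f x) ->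
  \int[tuple_measure m n.+1]_t f t =
  \int[m]_x \int[tuple_measure m n]_t f (tuple_cons (x, t)).
Proof.
move=> mf f0 /=; rewrite ge0_integral_pushforward//=.
rewrite fubini_tonelli1//.
by apply: measurableT_comp.
Qed.
End tuple_integral.

(** * Rotation invariance of Lebesgue measure *)

Section shear.
Local Open Scope ereal_scope.
Context (R : realType) (d : nat).
Local Notation V := 'rV[R]_d.+2.
Local Notation mu := (@lebesgue_measure R).
Local Notation i0 := (ord0 : 'I_d.+2).
Local Notation i1 := (lift ord0 ord0 : 'I_d.+2).

Definition rV_cons2 (a b : measurableTypeR R)
    (w : d.-tuple (measurableTypeR R)) : V :=
  rV_of_tuple (tuple_cons (a, tuple_cons (b, w))).

Definition plane_map (a b c e : R) (x : V) : V :=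
  \row_i if i == i0 then (a * x ord0 i0 + b * x ord0 i1)%R
         else if i == i1 then (c * x ord0 i0 + e * x ord0 i1)%R
         else x ord0 i.

Lemma measurable_plane_map a b c e : measurable_fun setT (plane_map a b c e).
Proof.
apply: measurable_fun_rV => i; under eq_fun do rewrite mxE.
case: (i == i0); last case: (i == i1).
- by apply: measurable_funD; apply: measurable_funM => //; exact: measurable_coord.
- by apply: measurable_funD; apply: measurable_funM => //; exact: measurable_coord.
- exact: measurable_coord.
Qed.

Lemma plane_map_cons2 a b c e x y w :
  plane_map a b c e (rV_cons2 x y w) =
  rV_cons2 (a * x + b * y)%R (c * x + e * y)%R w.
Proof.
apply/rowP => i; rewrite !mxE.
have [->|] := eqVneq i i0; first by rewrite !tnth0 tnthS tnth0.
have [->|] := eqVneq i i1; first by rewrite tnth0 !tnthS !tnth0.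
case: (unliftP ord0 i) => [j ->|->//].
by case: (unliftP ord0 j) => [k ->|->//]; rewrite !tnthS.
Qed.

(** Singles out the two coordinates of the plane in which rotations act, so that
    shears of this plane reduce to translations of the line. *)
Lemma ge0_integral_lebesgue_rV_cons2 (f : V -> \bar R) :
  measurable_fun setT f -> (forall x, 0 <= f x) ->
  \int[@lebesgue_rV R d.+2]_x f x =
  \int[mu]_a \int[mu]_b \int[tuple_measure mu d]_w f (rV_cons2 a b w).
Proof.
move=> mf f0.
have mrV n : measurable_fun setT (@rV_of_tuple R n) by [].
rewrite /lebesgue_rV ge0_integral_pushforward//= preimage_setT.
have mfr : measurable_fun setT (f \o @rV_of_tuple R d.+2) by exact: measurableT_comp.
rewrite ge0_integral_tuple_measureS//.
apply: eq_integral => a _.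
rewrite ge0_integral_tuple_measureS//.
apply: measurableT_comp mfr _.
by apply: (measurable_cons (f := cst a) (g := id)).
Qed.

Lemma measurable_rV_cons2 dT (T : measurableType dT) (f g : T -> measurableTypeR R)
   (h : T -> d.-tuple (measurableTypeR R)) :
  measurable_fun setT f -> measurable_fun setT g -> measurable_fun setT h ->
  measurable_fun setT (fun t => rV_cons2 (f t) (g t) (h t)).
Proof.
move=> mf mg mh; apply: (measurableT_comp (f := @rV_of_tuple R d.+2)) => //.
apply: (measurable_cons (f := f) (g := fun t => tuple_cons (g t, h t))) => //.
exact: (measurable_cons mg mh).
Qed.

Let G (f : V -> \bar R) (ab : measurableTypeR R * measurableTypeR R) :=
  \int[tuple_measure mu d]_w f (rV_cons2 ab.1 ab.2 w).

Let mG f : measurable_fun setT f -> (forall x, 0 <= f x) ->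
  measurable_fun setT (G f).
Proof.
move=> mf f0.
pose F (z : (measurableTypeR R * measurableTypeR R) *
    d.-tuple (measurableTypeR R)) := f (rV_cons2 z.1.1 z.1.2 z.2).
apply: (@measurable_fun_fubini_tonelli_F _ _ _ _ R (tuple_measure mu d) F);
  last by move=> z; exact: f0.
apply: (measurableT_comp mf); apply: measurable_rV_cons2.
- exact: (measurableT_comp measurable_fst measurable_fst).
- exact: (measurableT_comp measurable_snd measurable_fst).
- exact: measurable_snd.
Qed.

(** With the first coordinate fixed, the second one is translated. *)
Lemma lebesgue_rV_vertical_shear s (f : V -> \bar R) :
  measurable_fun setT f -> (forall x, 0 <= f x) ->
  \int[@lebesgue_rV R d.+2]_x f (plane_map 1 0 s 1 x) =
  \int[@lebesgue_rV R d.+2]_x f x.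
Proof.
move=> mf f0; have mfp := measurableT_comp mf (measurable_plane_map 1 0 s 1).
rewrite (ge0_integral_lebesgue_rV_cons2 mf f0).
rewrite [LHS](ge0_integral_lebesgue_rV_cons2 mfp); last by move=> x; exact: f0.
apply: eq_integral => a _.
rewrite -[RHS](ge0_integral_translation (s * a)); last 2 first.
- exact: (measurable_fun_pair2 a (mG mf f0)).
- by move=> x; exact: integral_ge0.
apply: eq_integral => b _; apply: eq_integral => w _ /=.
by rewrite plane_map_cons2 !mul1r mul0r addr0 (addrC b).
Qed.

(** As for the vertical shear, after exchanging the two integrals. *)
Lemma lebesgue_rV_horizontal_shear t (f : V -> \bar R) :
  measurable_fun setT f -> (forall x, 0 <= f x) ->
  \int[@lebesgue_rV R d.+2]_x f (plane_map 1 t 0 1 x) =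
  \int[@lebesgue_rV R d.+2]_x f x.
Proof.
move=> mf f0; have mfp := measurableT_comp mf (measurable_plane_map 1 t 0 1).
rewrite (ge0_integral_lebesgue_rV_cons2 mf f0).
rewrite [LHS](ge0_integral_lebesgue_rV_cons2 mfp); last by move=> x; exact: f0.
rewrite [RHS](fubini_tonelli (G f)); last 2 first.
- exact: mG.
- by move=> x; exact: integral_ge0.
rewrite (fubini_tonelli (G (f \o plane_map 1 t 0 1))); last 2 first.
- by apply: mG => // x; exact: f0.
- by move=> x; apply: integral_ge0 => w _; exact: f0.
apply: eq_integral => b _.
rewrite -[RHS](ge0_integral_translation (t * b)); last 2 first.
- exact: (measurable_fun_pair1 b (mG mf f0)).
- by move=> x; exact: integral_ge0.
apply: eq_integral => a _; apply: eq_integral => w _ /=.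
by rewrite plane_map_cons2 !mul1r mul0r add0r.
Qed.

Lemma plane_map_comp a b c e a' b' c' e' x :
  plane_map a b c e (plane_map a' b' c' e' x) =
  plane_map (a * a' + b * c') (a * b' + b * e')
            (c * a' + e * c') (c * b' + e * e') x.
Proof.
have i10 : (i1 == i0) = false by [].
apply/rowP => i; rewrite !mxE !eqxx i10.
have [_|_] := eqVneq i i0; first by ring.
by have [_|_] := eqVneq i i1; first by ring.
Qed.

Definition rotation (t : R) := plane_map (cos t) (- sin t) (sin t) (cos t).

Lemma rotationD s t x : rotation (s + t) x = rotation s (rotation t x).
Proof.
by rewrite /rotation plane_map_comp cosD sinD; congr (plane_map _ _ _ _ x); ring.
Qed.

(** A rotation is a product of three shears, with parameters - tan (t / 2), sin t
    and - tan (t / 2), where tan (t / 2) = sin t / (1 + cos t). *)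
Lemma lebesgue_rV_rotation t (f : V -> \bar R) : (0 < 1 + cos t)%R ->
  measurable_fun setT f -> (forall x, 0 <= f x) ->
  \int[@lebesgue_rV R d.+2]_x f (rotation t x) = \int[@lebesgue_rV R d.+2]_x f x.
Proof.
move=> c0 mf f0.
pose h := plane_map 1 (- (sin t / (1 + cos t))) 0 1.
pose v := plane_map 1 0 (sin t) 1.
have mfh := measurableT_comp mf (measurable_plane_map 1 (- (sin t / (1 + cos t))) 0 1).
have mfhv := measurableT_comp mfh (measurable_plane_map 1 0 (sin t) 1).
(* each of the four entries of the product is an identity between polynomials in
     cos t and sin t once multiplied by 1 + cos t *)
have rotE x : rotation t x = h (v (h x)).
  rewrite /rotation /h /v !plane_map_comp; have := cos2Dsin2 t.
  move=> cs; congr (plane_map _ _ _ _ x); apply: (mulfI (lt0r_neq0 c0)).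
  - rewrite [RHS](_ : _ = 1 + cos t - sin t ^+ 2)%R; last by field; lra.
    lra.
  - rewrite [RHS](_ : _ = - sin t *+ 2 + sin t ^+ 3 / (1 + cos t))%R; last by field; lra.
    rewrite (_ : sin t ^+ 3 = sin t * ((1 - cos t) * (1 + cos t)))%R.
      by rewrite mulrA mulfK ?lt0r_neq0//; ring.
    by rewrite exprS; congr *%R; lra.
  - by field; lra.
  - rewrite [RHS](_ : _ = 1 + cos t - sin t ^+ 2)%R; last by field; lra.
    lra.
under eq_integral do rewrite rotE.
rewrite (lebesgue_rV_horizontal_shear _ (f := f \o h \o v))//; last by move=> x; exact: f0.
rewrite (lebesgue_rV_vertical_shear _ (f := f \o h))//; last by move=> x; exact: f0.
exact: lebesgue_rV_horizontal_shear.
Qed.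
End shear.

(** * Prisms over regular polygons *)

Section prism.
Context (R : realType) (d : nat).
Local Notation V := 'rV[R]_d.+2.
Local Notation i0 := (ord0 : 'I_d.+2).
Local Notation i1 := (lift ord0 ord0 : 'I_d.+2).
Implicit Types (x y : V) (t r : R).

Definition plane_coord t x : R := x ord0 i0 * cos t + x ord0 i1 * sin t.

(** The product of a cube with the regular polygon with K sides, inradius r and
    outer normals at the angles t + 2 l pi / K. Letting l range over all integers
    lists every normal infinitely often, but makes the family of constraints
    invariant under the shifts of l. *)
Definition prism (r : R) (K : nat) (t : R) : set V :=
  [set x | (forall l : int, plane_coord (t + l%:~R * (2 * (pi / K%:R))) x <= r) /\
           (forall i, i != i0 -> i != i1 -> `|x ord0 i| <= r)].

Lemma enorm_ge0 n (x : 'rV[R]_n) : 0 <= enorm x.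
Proof. exact: sqrtr_ge0. Qed.

Lemma enorm_sqr n (x : 'rV[R]_n) : enorm x ^+ 2 = \sum_i x ord0 i ^+ 2.
Proof. by rewrite sqr_sqrtr// sumr_ge0// => i _; exact: sqr_ge0. Qed.

Lemma coord_le_enorm n (x : 'rV[R]_n) i : `|x ord0 i| <= enorm x.
Proof.
rewrite -(@ler_pXn2r _ 2)// ?nnegrE ?enorm_ge0// enorm_sqr (bigD1 i)//=.
by rewrite real_normK ?num_real// lerDl sumr_ge0// => j _; exact: sqr_ge0.
Qed.

Lemma big_plane_split (f : 'I_d.+2 -> R) :
  \sum_i f i = f i0 + f i1 + \sum_(i | (i != i0) && (i != i1)) f i.
Proof. by rewrite (bigD1 i0)//= (bigD1 i1)//= addrA. Qed.

(** The Cauchy-Schwarz inequality for a unit vector of the plane. *)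
Lemma plane_coord_le_enorm t x : plane_coord t x <= enorm x.
Proof.
apply: (le_trans (ler_norm _)).
rewrite -(@ler_pXn2r _ 2)// ?nnegrE ?enorm_ge0// enorm_sqr.
rewrite real_normK ?num_real// big_plane_split.
have := cos2Dsin2 t; rewrite /plane_coord.
set c := cos t; set s := sin t; set a := x ord0 i0; set b := x ord0 i1 => cs.
have S0 : 0 <= \sum_(i | (i != i0) && (i != i1)) x ord0 i ^+ 2.
  by rewrite sumr_ge0// => j _; exact: sqr_ge0.
have : 0 <= (a * s - b * c) ^+ 2 by exact: sqr_ge0.
have -> : (a * s - b * c) ^+ 2 =
  (a ^+ 2 + b ^+ 2) * (c ^+ 2 + s ^+ 2) - (a * c + b * s) ^+ 2 by ring.
rewrite cs; lra.
Qed.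

Lemma plane_coordB t x y : plane_coord t (x - y) = plane_coord t x - plane_coord t y.
Proof. by rewrite /plane_coord !mxE; ring. Qed.

Lemma plane_coord_rotation s t x :
  plane_coord (t + s) (rotation s x) = plane_coord t x.
Proof.
rewrite /plane_coord /rotation !mxE !eqxx (_ : (i1 == i0) = false)// cosD sinD.
have cs : cos s ^+ 2 + sin s ^+ 2 = 1 := cos2Dsin2 s.
rewrite [LHS](_ : _ = (x ord0 i0 * cos t + x ord0 i1 * sin t) *
  (cos s ^+ 2 + sin s ^+ 2)); last by ring.
by rewrite cs mulr1.
Qed.

Lemma prism_rotation r K s t x :
  prism r K (t + s) (rotation s x) <-> prism r K t x.
Proof.
have E l : plane_coord (t + s + l%:~R * (2 * (pi / K%:R))) (rotation s x) =
    plane_coord (t + l%:~R * (2 * (pi / K%:R))) x.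
  by rewrite addrAC plane_coord_rotation.
have F i : i != i0 -> i != i1 -> rotation s x ord0 i = x ord0 i.
  by move=> /negPf h0 /negPf h1; rewrite /rotation mxE h0 h1.
split=> -[h1 h2]; split=> [l|i n0 n1].
- by rewrite -E; exact: h1.
- by rewrite -F//; exact: h2.
- by rewrite E; exact: h1.
- by rewrite F//; exact: h2.
Qed.

(** A rotation by the angle between consecutive normals only reindexes them. *)
Lemma prismD r K t (m : int) :
  prism r K (t + m%:~R * (2 * (pi / K%:R))) = prism r K t.
Proof.
apply/seteqP; split=> x [h1 h2]; split=> // l.
  have := h1 (l - m); rewrite -addrA -mulrDl -intrD.
  by rewrite (_ : m + (l - m) = l)//; ring.
by have := h1 (m + l); rewrite -addrA -mulrDl -intrD.
Qed.

Lemma enorm_rotation s x : enorm (rotation s x) = enorm x.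
Proof.
congr Num.sqrt; rewrite !big_plane_split; congr (_ + _).
  rewrite /rotation !mxE !eqxx (_ : (i1 == i0) = false)//.
  have cs : cos s ^+ 2 + sin s ^+ 2 = 1 := cos2Dsin2 s.
  rewrite [LHS](_ : _ = (x ord0 i0 ^+ 2 + x ord0 i1 ^+ 2) *
    (cos s ^+ 2 + sin s ^+ 2)); last by ring.
  by rewrite cs mulr1.
apply: eq_bigr => i /andP[/negPf h0 /negPf h1].
by rewrite /rotation mxE h0 h1.
Qed.

Lemma eball_prism r K t : eball 0 r `<=` prism r K t.
Proof.
move=> x; rewrite /eball/= subr0 => xr; split => [l|i _ _].
  exact: le_trans (plane_coord_le_enorm _ _) xr.
exact: le_trans (coord_le_enorm _ _) xr.
Qed.

(** With a multiple of 4 sides, the four directions of the axes of the plane are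
    among the normals, and the polygon lies in a square of half-width r. *)
Lemma prism0_coord r (k : nat) x i : (0 < k)%N -> prism r (4 * k) 0 x ->
  `|x ord0 i| <= r.
Proof.
move=> k0 [h1 h2].
have k0R : k%:R != 0 :> R by rewrite pnatr_eq0; lia.
(* every k-th normal is a multiple of a quarter turn *)
have quarter (q : int) :
    plane_coord (q%:~R * (pi / 2)) x <= r.
  have := h1 (q * k); rewrite add0r intrM -pmulrn.
  by rewrite (_ : _ * (2 * _) = q%:~R * (pi / 2))// natrM; field.
have [->|n0] := eqVneq i i0.
  rewrite ler_norml; apply/andP; split.
    have := quarter 2; rewrite /plane_coord (_ : 2%:~R * _ = pi); last by field.
    by rewrite cospi sinpi; lra.
  by have := quarter 0; rewrite /plane_coord mul0r cos0 sin0; lra.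
have [->|n1] := eqVneq i i1; last exact: h2.
rewrite ler_norml; apply/andP; split.
  have := quarter (- 1); rewrite /plane_coord (_ : (-1)%:~R * _ = - (pi / 2)); last by ring.
  by rewrite cosN sinN cos_pihalf sin_pihalf; lra.
have := quarter 1; rewrite /plane_coord (_ : 1%:~R * _ = pi / 2); last by ring.
by rewrite cos_pihalf sin_pihalf; lra.
Qed.

Lemma prism0_sub_eball r (k : nat) : (0 < k)%N ->
  prism r (4 * k) 0 `<=` eball 0 (Num.sqrt d.+2%:R * r).
Proof.
move=> k0 x Px; rewrite /eball/= subr0.
have r0 : 0 <= r by rewrite (le_trans _ (prism0_coord i0 k0 Px)).
rewrite -(@ler_pXn2r _ 2)// ?nnegrE ?enorm_ge0 ?mulr_ge0//.
rewrite enorm_sqr exprMn sqr_sqrtr// mulr_natl -[X in _ *+ X]card_ord -sumr_const.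
apply: ler_sum => i _; rewrite -[leLHS]real_normK ?num_real//.
by rewrite ler_pXn2r ?nnegrE//; exact: prism0_coord Px.
Qed.

(** [prism0_sub_eball] transported by a rotation, which preserves the norm. *)
Lemma prism_sub_eball r (k : nat) t : (0 < k)%N ->
  prism r (4 * k) t `<=` eball 0 (Num.sqrt d.+2%:R * r).
Proof.
move=> k0 x Px; rewrite /eball/= subr0 -(enorm_rotation (- t)) -[X in enorm X]subr0.
apply: (prism0_sub_eball k0); rewrite -(subrr t); exact/prism_rotation.
Qed.

Lemma prism_convex r K t : convex_set (prism r K t : set (convex_lmodType V)).
Proof.
move=> x y l /set_mem[hx1 hx2] /set_mem[hy1 hy2]; apply/mem_set.
have l0 : 0 <= l%:num by []. have l1 : l%:num <= 1 by [].
have E i : (convex.conv l x y : V) ord0 i = l%:num * x ord0 i + (1 - l%:num) * y ord0 i.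
  by rewrite !mxE.
have cvx (a b c : R) : a <= c -> b <= c -> l%:num * a + (1 - l%:num) * b <= c.
  by move=> ac bc; nra.
split=> [m|i n0 n1].
  have := cvx _ _ _ (hx1 m) (hy1 m); apply: le_trans.
  by rewrite /plane_coord !E le_eqVlt; apply/orP; left; apply/eqP; ring.
rewrite E; apply: le_trans (cvx _ _ _ (hx2 i n0 n1) (hy2 i n0 n1)).
rewrite (le_trans (ler_normD _ _))// !normrM (ger0_norm l0).
by rewrite (ger0_norm (_ : 0 <= 1 - _)) ?subr_ge0.
Qed.

Lemma prism_closed r K t : closed (prism r K t).
Proof.
have cc (i : 'I_d.+2) : continuous (fun x : V => x ord0 i) by exact: coord_continuous.
have -> : prism r K t =
    (\bigcap_(l in [set: int])
        (plane_coord (t + l%:~R * (2 * (pi / K%:R)))) @^-1` [set y : R | y <= r]) `&`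
    (\bigcap_(i in [set i : 'I_d.+2 | i != i0 /\ i != i1])
        (fun x : V => `|x ord0 i|) @^-1` [set y : R | y <= r]).
  apply/seteqP; split=> x.
    by move=> [h1 h2]; split=> [l _|i [n0 n1]]; [exact: h1|exact: h2].
  by move=> [h1 h2]; split=> [l|i n0 n1]; [exact: h1|exact: h2].
have pc (f : V -> R) : continuous f -> closed (f @^-1` [set y : R | y <= r]).
  move=> cf; have := @preimage_closed V R f [set y : R | y <= r] _ (@closed_le R r).
  by apply=> x _; exact: cf.
apply: closedI; apply: closed_bigI => j _; apply: pc => x.
- exact: (cvgD (cvgM (cc i0 x) (cvg_cst _)) (cvgM (cc i1 x) (cvg_cst _))).
- exact: (cvg_norm (cc j x)).
Qed.

Lemma prism_interior r K t : 0 < r -> (prism r K t)° !=set0.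
Proof.
move=> r0; exists 0; apply/nbhs_ballP; exists (r / 2) => /=; first by rewrite divr_gt0.
move=> x [_ xr]; have {xr} xr i : `|x ord0 i| < r / 2.
  by have := xr ord0 i; rewrite -ball_normE/= mxE sub0r normrN.
split=> [l|i _ _]; last by rewrite ltW// (lt_trans (xr i))// ltr_pdivrMr//; lra.
set a := t + _; apply: (le_trans (ler_norm _)); apply: (le_trans (ler_normD _ _)).
rewrite !normrM; have := ltW (xr i0); have := ltW (xr i1).
have := cos_max a; have := sin_max a.
have := normr_ge0 (cos a); have := normr_ge0 (sin a).
have := normr_ge0 (x ord0 i0); have := normr_ge0 (x ord0 i1); nra.
Qed.

Lemma exists_prism_body r (k : nat) t : 0 < r -> (0 < k)%N ->
  exists G : convex_body R d.+2, body G = prism r (4 * k) t.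
Proof.
move=> r0 k0.
have cP : compact (prism r (4 * k) t).
  apply: bounded_closed_compact; last exact: prism_closed.
  exists (Num.sqrt d.+2%:R * r); split; first exact: num_real.
  move=> M ltM x /(prism_sub_eball k0); rewrite /eball/= subr0 => xr.
  have M0 : 0 <= M by rewrite (le_trans _ (ltW ltM))// mulr_ge0// ltW.
  rewrite [leLHS]/Num.norm/= mx_normrE; apply/bigmax_leP; split => // -[i j] _ /=.
  by rewrite ord1 (le_trans (coord_le_enorm _ _))// (le_trans xr)// ltW.
by exists (ConvexBody (@prism_convex r (4 * k) t) cP (@prism_interior r (4 * k) t r0)).
Qed.

Lemma plane_coordD t x y : plane_coord t (x + y) = plane_coord t x + plane_coord t y.
Proof. by rewrite /plane_coord !mxE; ring. Qed.

Lemma plane_coordZ t (a : R) x : plane_coord t (a *: x) = a * plane_coord t x.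
Proof. by rewrite /plane_coord !mxE; ring. Qed.

(** The point v is the vertex of the first polygon in the direction h = pi / K,
    which is normal to a side of the second polygon. It stands at distance
    r / cos h from the centre, against r for that side. *)
Lemma prism_vertex r (K : nat) : 0 < r -> (2 < K)%N ->
  exists2 v, prism r K 0 v & forall g, prism r K (pi / K%:R) g ->
    r * (1 - cos (pi / K%:R)) <= plane_coord (pi / K%:R) (v - g).
Proof.
move=> r0 K2; have K0 : 0 < K%:R :> R by rewrite ltr0n; lia.
set h := pi / K%:R.
have K3 : 3 <= K%:R :> R by rewrite ler_nat.
have h0 : 0 < h by rewrite divr_gt0 ?pi_gt0.
have c0 : 0 < cos h.
  apply: cos_gt0_pihalf; have pi0 := @pi_gt0 R; rewrite (lt_trans _ h0)/=; last by lra.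
  by rewrite /h ltr_pdivrMr//; nra.
have c1 := cos_le1 h; have cs := cos2Dsin2 h.
pose v : V := \row_i if i == i0 then r else if i == i1 then r * sin h / cos h else 0.
have pcv s : plane_coord s v = r / cos h * cos (s - h).
  rewrite /plane_coord !mxE eqxx (_ : (i1 == i0) = false)// eqxx cosB.
  by field; rewrite gt_eqF.
exists v => [|g [/(_ 0) + _]].
  split=> [l|i /negPf n0 /negPf n1]; last by rewrite mxE n0 n1 normr0 ltW.
  rewrite pcv -mulrA ler_piMr ?(ltW r0)// (mulrC (cos h)^-1) ler_pdivrMr// mul1r.
  rewrite (_ : 0 + l%:~R * (2 * (pi / K%:R)) - h = (2 * l%:~R - 1) * h).
    by apply: cos_odd_le_cos; lia.
  by rewrite /h; ring.
rewrite mul0r addr0 -/h => hg; rewrite plane_coordB pcv subrr cos0 mulr1.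
(* equivalent to (1 - cos h)^2 >= 0 *)
have rc : r * (2 - cos h) <= r / cos h.
  by rewrite ler_pM2l// -[leRHS]mul1r ler_pdivlMr//; nra.
lra.
Qed.

(** If S is within t of both A and B, then v is within t of a point of S that is
    within t of a point of B. Displacements are measured by a linear form of
    Euclidean norm one, so that they simply add up. *)
Lemma hausdorff_two_point (A B S : set V) v s (D t : R) :
  A v -> (forall g, B g -> D <= plane_coord s (v - g)) ->
  (hausdorff_dist A S <= t%:E)%E -> (hausdorff_dist B S <= t%:E)%E -> D <= 2 * t.
Proof.
move=> Av BD hA hB; apply/ler_addgt0Pr => e e0.
have e20 : 0 < e / 2 by rewrite divr_gt0.
have [_ [e1 [e10 AS _] <-]] : exists2 y, [set e%:E | e in [set e : R | [/\ 0 < e,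
    A `<=` [set b + e *: u | b in S & u in eball 0 1] &
    S `<=` [set a + e *: u | a in A & u in eball 0 1]]]] y & (y < (t + e / 2)%:E)%E.
  by apply: ereal_inf_lt; rewrite (le_lt_trans hA)// lte_fin ltrDl.
have [_ [e2 [e20' _ SB] <-]] : exists2 y, [set e%:E | e in [set e : R | [/\ 0 < e,
    B `<=` [set b + e *: u | b in S & u in eball 0 1] &
    S `<=` [set a + e *: u | a in B & u in eball 0 1]]]] y & (y < (t + e / 2)%:E)%E.
  by apply: ereal_inf_lt; rewrite (le_lt_trans hB)// lte_fin ltrDl.
rewrite !lte_fin => e2t e1t.
have [b Sb [u u1 ub]] := AS _ Av; have [g Bg [w w1 wg]] := SB _ Sb.
have := BD _ Bg; rewrite -ub -wg addrAC (addrC g) addrK.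
rewrite /eball/= !subr0 in u1 w1.
have pu := le_trans (plane_coord_le_enorm s u) u1.
have pw := le_trans (plane_coord_le_enorm s w) w1.
rewrite plane_coordD !plane_coordZ; nra.
Qed.
End prism.

(** * The Gaussian law: translation formula and exponential moments *)

Section gaussian.
Local Open Scope ereal_scope.
Context (R : realType) (sigma : R).
Hypothesis sigma0 : (0 < sigma)%R.
Local Notation mu := (@lebesgue_measure R).
Local Notation N := (normal_prob (0 : R) sigma).

(** The density at z of the normal law with mean x and standard deviation sigma
    with respect to the centered one. *)
Definition tilt (x z : R) : R := expR ((x * z - x ^+ 2 / 2) / sigma ^+ 2).

Lemma measurable_tilt x : measurable_fun setT (tilt x : measurableTypeR R -> R).
Proof.
apply: measurableT_comp => //; apply: measurable_funM => //.
by apply: measurable_funB => //; exact: measurable_funM.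
Qed.

Lemma normal_pdf_translation x z :
  normal_pdf 0 sigma (z - x) = (tilt x z * normal_pdf 0 sigma z)%R.
Proof.
have pdfE y : normal_pdf 0 sigma y = (normal_peak sigma * normal_fun 0 sigma y)%R.
  by rewrite normal_pdfE// gt_eqF.
rewrite !pdfE /tilt mulrCA -expRD.
congr (_ * expR _)%R; rewrite !subr0.
by field; rewrite gt_eqF.
Qed.

(** The Cameron-Martin formula on the line. *)
Lemma ge0_integral_normal_translation x (f : measurableTypeR R -> \bar R) :
  measurable_fun setT f -> (forall z, 0 <= f z) ->
  \int[N]_e f (x + e)%R = \int[N]_z (f z * (tilt x z)%:E).
Proof.
move=> mf f0.
have mpdf := measurable_normal_pdf (0 : R) sigma.
have pdf0 := normal_pdf_ge0 (0 : R) sigma.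
have mfx : measurable_fun setT (fun e : measurableTypeR R => f (x + e)%R).
  by apply: (measurableT_comp mf); exact: measurable_funD.
have mft : measurable_fun setT (fun z => f z * (tilt x z)%:E).
  by apply: emeasurable_funM => //; apply/measurable_EFinP; exact: measurable_tilt.
rewrite (ge0_integral_density (mu := mu) mpdf pdf0 _ mfx)//.
rewrite (ge0_integral_density (mu := mu) mpdf pdf0 _ mft)//; last first.
  by move=> z; rewrite mule_ge0// lee_fin expR_ge0.
rewrite -[RHS](ge0_integral_translation x); last 2 first.
- by apply: emeasurable_funM => //; exact/measurable_EFinP.
- by move=> z; rewrite !mule_ge0// lee_fin ?expR_ge0.
apply: eq_integral => e _.
by rewrite -muleA -EFinM -normal_pdf_translation addrK addrC.
Qed.

(** Up to a constant factor, the integrand is the tilt by b sigma^2, whose integral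
    is 1 since it is a density. *)
Lemma integral_normal_expR (b : R) :
  \int[N]_z (expR (b * z))%:E = (expR (b ^+ 2 * sigma ^+ 2 / 2))%:E.
Proof.
have s0 : sigma != 0%R by rewrite gt_eqF.
have mb : measurable_fun setT (fun z : measurableTypeR R => (expR (b * z)%R)%:E).
  by apply/measurable_EFinP; apply: measurableT_comp => //; exact: measurable_funM.
set c := expR _.
transitivity (c%:E * \int[N]_z (1 * (tilt (b * sigma ^+ 2) z)%:E)).
  rewrite -ge0_integralZl//; last 3 first.
  - apply: emeasurable_funM => //; apply/measurable_EFinP; exact: measurable_tilt.
  - by move=> z _; rewrite mul1e lee_fin expR_ge0.
  - by rewrite lee_fin expR_ge0.
  apply: eq_integral => z _; rewrite mul1e -EFinM -expRD.
  by congr (expR _)%:E; field.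
rewrite -(ge0_integral_normal_translation (b * sigma ^+ 2) (f := cst 1))//.
have NT : N setT = 1 by exact: probability_setT.
by rewrite integral_cst// [X in _ * (_ * X)]NT !mule1.
Qed.

Lemma integral_normal_expR_abs (b : R) :
  \int[N]_z (expR (b * `|z|))%:E <= (2 * expR (b ^+ 2 * sigma ^+ 2 / 2))%:E.
Proof.
have mb c : measurable_fun setT (fun z : measurableTypeR R => (expR (c * z)%R)%:E).
  by apply/measurable_EFinP; apply: measurableT_comp => //; exact: measurable_funM.
apply: (@le_trans _ _ (\int[N]_z ((expR (b * z))%:E + (expR (- b * z))%:E))).
  apply: ge0_le_integral => //.
  - apply/measurable_EFinP; apply: measurableT_comp => //.
    by apply: measurable_funM => //; exact: normr_measurable.
  - exact: emeasurable_funD.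
  move=> z _; rewrite -EFinD lee_fin; case: (ger0P z) => _.
    by rewrite lerDl expR_ge0.
  by rewrite mulrN -mulNr lerDr expR_ge0.
rewrite ge0_integralD//.
by rewrite !integral_normal_expR sqrrN -EFinD mulr_natl mulr2n.
Qed.

End gaussian.

Section gaussian_rV.
Local Open Scope ereal_scope.
Context (R : realType) (sigma : R).
Hypothesis sigma0 : (0 < sigma)%R.
Local Notation N := (normal_prob (0 : R) sigma).
Local Notation tN n := (tuple_measure (normal_prob (0 : R) sigma) n).
Local Notation T := (measurableTypeR R).

Definition tilt_rV d (x z : 'rV[R]_d) : R :=
  \prod_(i < d) tilt sigma (x ord0 i) (z ord0 i).

Let shift n (x : 'I_n -> R) (t : n.-tuple T) : n.-tuple T :=
  [tuple (x i + tnth t i)%R : T | i < n].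

Let mshift n (x : 'I_n -> R) : measurable_fun setT (@shift n x).
Proof.
apply/measurable_fun_tnthP => i; rewrite /comp.
under eq_fun do rewrite tnth_mktuple.
by apply: measurable_funD => //; exact: measurable_tnth.
Qed.

Let tilts n (x : 'I_n -> R) (t : n.-tuple T) : R :=
  (\prod_(i < n) tilt sigma (x i) (tnth t i))%R.

Let mtilts n (x : 'I_n -> R) : measurable_fun setT (@tilts n x).
Proof.
apply: measurable_prod => i _.
by apply: (measurableT_comp (measurable_tilt sigma (x i))); exact: measurable_tnth.
Qed.

Let tilts_ge0 n (x : 'I_n -> R) t : (0 <= tilts x t)%R.
Proof. by apply: prodr_ge0 => i _; exact: expR_ge0. Qed.

Let shift_cons n (x : 'I_n.+1 -> R) a t :
  shift x (tuple_cons (a, t)) =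
  tuple_cons ((x ord0 + a)%R : T, shift (fun i => x (lift ord0 i)) t).
Proof.
apply/eq_from_tnth => i; rewrite tnth_mktuple.
by case: (unliftP ord0 i) => [j ->|->]; rewrite ?tnthS ?tnth0 ?tnth_mktuple.
Qed.

Let tilts_cons n (x : 'I_n.+1 -> R) a t :
  tilts x (tuple_cons (a, t)) =
  (tilts (fun i => x (lift ord0 i)) t * tilt sigma (x ord0) a)%R.
Proof.
rewrite /tilts big_ord_recl tnth0 mulrC; congr (_ * _)%R.
by apply: eq_bigr => i _; rewrite tnthS.
Qed.

Let mcons n (a : T) : measurable_fun setT (fun t : n.-tuple T => tuple_cons (a, t)).
Proof. exact: (measurable_cons (f := cst a) (g := id)). Qed.

Let ge0_integral_shift n (x : 'I_n -> R) (f : n.-tuple T -> \bar R) :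
  measurable_fun setT f -> (forall z, 0 <= f z) ->
  \int[tN n]_t f (shift x t) = \int[tN n]_t (f t * (tilts x t)%:E).
Proof.
elim: n x f => [|n IHn] x f mf f0.
  rewrite !ge0_integral_tuple_measure0//; last 2 first.
  - by apply: emeasurable_funM => //; apply/measurable_EFinP; exact: mtilts.
  - exact: (measurableT_comp mf (mshift x)).
  by rewrite /tilts big_ord0 mule1; congr f; rewrite tuple0.
pose x' := fun i => x (lift ord0 i).
have mft : measurable_fun setT (fun t => f t * (tilts x t)%:E).
  by apply: emeasurable_funM => //; apply/measurable_EFinP; exact: mtilts.
rewrite ge0_integral_tuple_measureS//; last exact: (measurableT_comp mf (mshift x)).
rewrite ge0_integral_tuple_measureS//; last first.
  by move=> t; rewrite mule_ge0// lee_fin.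
pose F (z : T * n.-tuple T) := f (tuple_cons z) * (tilts x' z.2)%:E.
have F0 z : 0 <= F z by rewrite mule_ge0// lee_fin.
have mF : measurable_fun setT F.
  apply: emeasurable_funM; first exact: measurableT_comp.
  by apply/measurable_EFinP; apply: (measurableT_comp (mtilts x')).
have mG : measurable_fun setT (fun a => \int[tN n]_t F (a, t)).
  exact: (@measurable_fun_fubini_tonelli_F _ _ _ _ R (tN n) F).
transitivity (\int[N]_a (fun a => \int[tN n]_t F (a, t)) (x ord0 + a)%R).
  apply: eq_integral => a _.
  under eq_integral do rewrite shift_cons.
  rewrite (IHn x' (fun t => f (tuple_cons ((x ord0 + a)%R : T, t))))//.
  exact: (measurableT_comp mf (mcons _)).
have G0 a : 0 <= \int[tN n]_t F (a, t) by exact: integral_ge0.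
rewrite [LHS](ge0_integral_normal_translation sigma0 (x ord0) mG G0).
apply: eq_integral => a _; rewrite -ge0_integralZr//.
- by apply: eq_integral => t _; rewrite /F tilts_cons -muleA -EFinM.
- exact: measurable_fun_pair2.
- by rewrite lee_fin expR_ge0.
Qed.

(** The Cameron-Martin formula for independent coordinates. *)
Lemma ge0_integral_gaussian_translation d (x : 'rV[R]_d) (f : 'rV[R]_d -> \bar R) :
  measurable_fun setT f -> (forall z, 0 <= f z) ->
  \int[gaussian_rV sigma]_e f (x + e)%R =
  \int[gaussian_rV sigma]_z (f z * (tilt_rV x z)%:E).
Proof.
move=> mf f0.
have mt : measurable_fun setT (tilt_rV x).
  apply: measurable_prod => i _.
  by apply: (measurableT_comp (measurable_tilt sigma (x ord0 i))); exact: measurable_coord.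
have t0 z : (0 <= tilt_rV x z)%R by apply: prodr_ge0 => i _; exact: expR_ge0.
have mfx : measurable_fun setT (fun e => f (x + e)%R).
  apply: (measurableT_comp mf); apply: measurable_fun_rV => i.
  under eq_fun do rewrite mxE.
  by apply: measurable_funD => //; exact: measurable_coord.
have mft : measurable_fun setT (fun z => f z * (tilt_rV x z)%:E).
  by apply: emeasurable_funM => //; exact/measurable_EFinP.
rewrite /gaussian_rV ge0_integral_distribution//.
rewrite ge0_integral_distribution//; last by move=> z; rewrite mule_ge0// lee_fin.
have mrV : measurable_fun setT (@rV_of_tuple R d) by [].
transitivity (\int[tN d]_t (f \o @rV_of_tuple R d) (shift (x ord0) t)).
  apply: eq_integral => t _ /=; congr f; apply/rowP => i.
  by rewrite !mxE tnth_mktuple.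
have mfr : measurable_fun setT (f \o @rV_of_tuple R d) by exact: measurableT_comp.
rewrite [LHS](ge0_integral_shift (x ord0) mfr); last by move=> t; exact: f0.
apply: eq_integral => t _ /=; congr (_ * _%:E); apply: eq_bigr => i _.
by rewrite mxE.
Qed.

Let mabs dT (X : measurableType dT) n (g : 'I_n -> X -> R) (b : R) :
  (forall i, measurable_fun setT (g i)) ->
  measurable_fun setT (fun z => (expR (b * \sum_i `|g i z|))%:E).
Proof.
move=> mg; apply/measurable_EFinP; apply: measurableT_comp => //.
apply: measurable_funM => //; apply: measurable_sum => i.
by apply: measurableT_comp => //; exact: mg.
Qed.

Lemma gaussian_exp_moment d (b : R) :
  \int[gaussian_rV sigma]_z (expR (b * \sum_(i < d) `|z ord0 i|))%:E
  <= ((2 * expR (b ^+ 2 * sigma ^+ 2 / 2)) ^+ d)%:E.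
Proof.
rewrite /gaussian_rV ge0_integral_distribution//; last first.
  exact: (mabs b (fun i : 'I_d => measurable_coord i)).
apply: (@le_trans _ _ (\int[tN d]_t (expR (b * \sum_(i < d) `|tnth t i|))%:E)).
  rewrite le_eqVlt; apply/orP; left; apply/eqP; apply: eq_integral => t _ /=.
  by congr (expR (_ * _))%:E; apply: eq_bigr => i _; rewrite mxE.
elim: d => [|d IHd].
  rewrite ge0_integral_tuple_measure0; first by rewrite big_ord0 mulr0 expR0.
  exact: (mabs b (@measurable_tnth _ T _)).
rewrite ge0_integral_tuple_measureS; last 2 first.
- exact: (mabs b (@measurable_tnth _ T _)).
- by move=> z; rewrite lee_fin expR_ge0.
pose C : R := (2 * expR (b ^+ 2 * sigma ^+ 2 / 2))%R.
have C0 : (0 <= C)%R by rewrite mulr_ge0 ?expR_ge0.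
have mE : measurable_fun setT (fun t : d.-tuple T => (expR (b * \sum_(i < d) `|tnth t i|))%:E).
  exact: (mabs b (@measurable_tnth _ T _)).
have mb : measurable_fun setT (fun a : T => (expR (b * `|a|)%R)%:E).
  apply/measurable_EFinP; apply: measurableT_comp => //.
  by apply: measurable_funM => //; exact: normr_measurable.
apply: (@le_trans _ _ (\int[N]_a ((expR (b * `|a|))%:E * (C ^+ d)%:E))).
  apply: ge0_le_integralT.
  - pose F (z : T * d.-tuple T) := (expR (b * \sum_(i < d.+1) `|tnth (tuple_cons z) i|))%:E.
    apply: (@measurable_fun_fubini_tonelli_F _ _ _ _ R (tN d) F).
      apply: (mabs (g := fun i (z : T * d.-tuple T) => tnth (tuple_cons z) i : R)).
      move=> i; apply: (measurableT_comp (measurable_tnth i)).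
      exact: (measurable_funP (@tuple_cons _ T d)).
    by move=> z; rewrite lee_fin expR_ge0.
  - exact: emeasurable_funM.
  - by move=> a; apply: integral_ge0 => t _; rewrite lee_fin expR_ge0.
  move=> a; apply: (@le_trans _ _ ((expR (b * `|a|))%:E *
      \int[tN d]_t (expR (b * \sum_(i < d) `|tnth t i|))%:E)); last first.
    by apply: lee_wpmul2l; [rewrite lee_fin expR_ge0|exact: IHd].
  rewrite -ge0_integralZl//.
  rewrite le_eqVlt; apply/orP; left; apply/eqP; apply: eq_integral => t _.
  rewrite -EFinM -expRD big_ord_recl tnth0 mulrDr; congr (expR (_ + _ * _))%:E.
  by apply: eq_bigr => i _; rewrite tnthS.
rewrite ge0_integralZr//; last by rewrite lee_fin exprn_ge0.
rewrite exprS EFinM lee_wpmul2r ?lee_fin ?exprn_ge0//.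
exact: integral_normal_expR_abs.
Qed.
End gaussian_rV.

(** * Comparison of the two Gaussian mixtures *)

Lemma sum_alternating_split (R : pzRingType) (a : nat -> R) (K : nat) :
  \sum_(l < K.*2) (-1) ^+ l * a l =
  \sum_(m < K) a m.*2 - \sum_(m < K) a m.*2.+1.
Proof.
elim: K => [|K IHK]; first by rewrite !big_ord0 subr0.
rewrite doubleS !big_ord_recr/= IHK exprS -mul2n exprM sqrrN !expr1n mul1r mulr1 mulN1r.
rewrite opprD !addrA; congr (_ - _); exact: addrAC.
Qed.

Lemma sume_const (R : realType) n (c : \bar R) :
  (0 <= c -> \sum_(m < n) c = n%:R%:E * c)%E.
Proof.
move=> c0; elim: n => [|n IHn]; first by rewrite big_ord0 mul0e.
by rewrite big_ord_recr/= IHn -natr1 EFinD ge0_muleDl ?lee_fin// mul1e.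
Qed.

Section averaging.
Local Open Scope ereal_scope.
Context dT (T : measurableType dT) (R : realType).
Variables (mu : {measure set T -> \bar R}) (p : T -> R) (u v : nat -> T -> R).
Hypotheses (mp : measurable_fun setT p) (p0 : forall x, (0 <= p x)%R).
Hypothesis p1 : \int[mu]_x (p x)%:E = 1.
Hypothesis u_measurable : forall m, measurable_fun setT (u m).
Hypothesis u0 : forall m x, (0 <= u m x)%R.
Hypothesis v_measurable : forall m, measurable_fun setT (v m).
Hypothesis v0 : forall m x, (0 <= v m x)%R.

(** Writing I and J as the means of n equal integrals allows the integrands to be
    compared through their sums only, where cancellations take place. *)
Lemma averaging_comparison n (c : R) (I J : \bar R) : (0 < n)%N -> (0 <= c)%R ->
  (forall m, \int[mu]_x (u m x * p x)%:E = I) ->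
  (forall m, \int[mu]_x (v m x * p x)%:E = J) ->
  (forall x, p x != 0%R ->
    (\sum_(m < n) u m x <= \sum_(m < n) v m x + n%:R * c)%R) ->
  I <= J + c%:E.
Proof.
move=> n0 c0 uI vJ uv.
have mup m : measurable_fun setT (fun x => (u m x * p x)%:E).
  by apply/measurable_EFinP; exact: measurable_funM.
have mvp m : measurable_fun setT (fun x => (v m x * p x)%:E).
  by apply/measurable_EFinP; exact: measurable_funM.
have up0 m x : 0 <= (u m x * p x)%:E by rewrite lee_fin mulr_ge0.
have vp0 m x : 0 <= (v m x * p x)%:E by rewrite lee_fin mulr_ge0.
have I0 : 0 <= I by rewrite -(uI 0%N); apply: integral_ge0 => x _.
have J0 : 0 <= J by rewrite -(vJ 0%N); apply: integral_ge0 => x _.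
have nc0 : (0 <= n%:R * c)%R by rewrite mulr_ge0.
have mcp : measurable_fun setT (fun x => (n%:R * c)%:E * (p x)%:E).
  by apply: emeasurable_funM => //; exact/measurable_EFinP.
have cp0 x : 0 <= (n%:R * c)%:E * (p x)%:E by rewrite -EFinM lee_fin mulr_ge0.
have nn0 : 0 < n%:R%:E :> \bar R by rewrite lte_fin ltr0n.
have nfin : (n%:R%:E : \bar R) \is a fin_num by [].
rewrite -(lee_pmul2l nfin nn0) ge0_muleDr// -EFinM -!sume_const//.
rewrite (eq_bigr _ (fun m _ => esym (uI (nat_of_ord m)))).
rewrite [X in _ <= X + _](eq_bigr _ (fun m _ => esym (vJ (nat_of_ord m)))).
rewrite -ge0_integral_sum// -ge0_integral_sum//.
have -> : (n%:R * c)%:E = \int[mu]_x ((n%:R * c)%:E * (p x)%:E).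
  have mEp : measurable_fun setT (EFin \o p) by exact/measurable_EFinP.
  have Ep0 x : [set: T] x -> 0 <= (EFin \o p) x by rewrite lee_fin.
  by rewrite (ge0_integralZl_EFin mu measurableT Ep0 mEp nc0) p1 mule1.
have sm (w : nat -> T -> R) : (forall m, measurable_fun setT (fun x => (w m x * p x)%:E)) ->
    measurable_fun setT (fun x => \sum_(m < n) (w m x * p x)%:E).
  by move=> mw; exact: (@emeasurable_sum _ _ _ _ _ _ (fun m : 'I_n => _)).
rewrite -ge0_integralD//; [|by move=> x _; exact: sume_ge0|exact: sm].
apply: ge0_le_integralT.
- exact: sm.
- by apply: emeasurable_funD => //; exact: sm.
- by move=> x; exact: sume_ge0.
move=> x; rewrite !sumEFin -EFinM -EFinD lee_fin -!mulr_suml -mulrDl.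
have [->|px0] := eqVneq (p x) 0%R; first by rewrite !mulr0.
by rewrite ler_wpM2r// uv.
Qed.
End averaging.

Section one_observation.
Context (R : realType) (d : nat).
Local Notation V := 'rV[R]_d.+2.
Local Notation i0 := (ord0 : 'I_d.+2).
Local Notation i1 := (lift ord0 ord0 : 'I_d.+2).
Local Notation leb := (@lebesgue_rV R d.+2).
Local Open Scope ereal_scope.

(** Iterating a rotation by a small angle also covers the half-turn, for which the
    decomposition into three shears breaks down. *)
Lemma lebesgue_rV_rotation_iter (h : R) (l : nat) (f : V -> \bar R) :
  (0 < 1 + cos h)%R -> measurable_fun setT f -> (forall x, 0 <= f x) ->
  \int[leb]_x f (rotation (l%:R * h) x) = \int[leb]_x f x.
Proof.
move=> h0; elim: l f => [|l IHl] f mf f0.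
  apply: eq_integral => x _; congr f; apply/rowP => i.
  rewrite mul0r /rotation mxE cos0 sin0 oppr0 !mul1r !mul0r addr0 add0r.
  by have [->//|_] := eqVneq i i0; have [->|] := eqVneq i i1.
have mfh : measurable_fun setT (f \o rotation h).
  exact: (measurableT_comp mf (measurable_plane_map _ _ _ _)).
transitivity (\int[leb]_x (f \o rotation h) (rotation (l%:R * h) x)).
  by apply: eq_integral => x _ /=; rewrite -rotationD -natr1 mulrDl mul1r (addrC h).
rewrite (IHl _ mfh (fun x => f0 _)).
exact: (lebesgue_rV_rotation h0 mf f0).
Qed.

Definition uniform_density (G : convex_body R d.+2) (x : V) : R :=
  (fine (leb G))^-1 * \1_(body G) x.

Lemma uniform_density_ge0 G x : (0 <= uniform_density G x)%R.
Proof. by rewrite mulr_ge0// invr_ge0 fine_ge0. Qed.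

Lemma measurable_uniform_density G : measurable_fun setT (uniform_density G).
Proof.
by apply: measurable_funM => //; apply: measurable_indic; exact: measurable_body.
Qed.

Lemma ge0_integral_uniform_body (G : convex_body R d.+2) (f : V -> \bar R) :
  measurable_fun setT f -> (forall x, 0 <= f x) ->
  \int[uniform_body G]_x f x = \int[leb]_x (f x * (uniform_density G x)%:E).
Proof.
move=> mf f0; apply: ge0_integral_density => //.
- exact: measurable_uniform_density.
- exact: uniform_density_ge0.
move=> A mA; rewrite /uniform_density; under eq_integral do rewrite EFinM.
have mG : measurable (body G) by exact: measurable_body.
rewrite ge0_integralZl//; last 2 first.
- by apply/measurable_EFinP/measurable_funTS; exact: measurable_indic.
- by rewrite lee_fin invr_ge0 fine_ge0.
by rewrite integral_indic// muleC setIC.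
Qed.

Variable (sigma : R).
Hypothesis sigma0 : (0 < sigma)%R.

(** A rotation of x preserves |x| and the coordinates outside the plane: only the
    scalar product in the plane depends on the angle, as a trigonometric
    polynomial of degree one. *)
Lemma tilt_rV_rotation (t : R) (x z : V) :
  tilt_rV sigma (rotation t x) z =
  (expR (- ((x ord0 i0 ^+ 2 + x ord0 i1 ^+ 2) / 2) / sigma ^+ 2) *
   \prod_(i | (i != i0) && (i != i1)) tilt sigma (x ord0 i) (z ord0 i) *
   expR ((x ord0 i0 * z ord0 i0 + x ord0 i1 * z ord0 i1) / sigma ^+ 2 * cos t +
         (x ord0 i0 * z ord0 i1 - x ord0 i1 * z ord0 i0) / sigma ^+ 2 * sin t))%R.
Proof.
have s0 : (sigma != 0)%R by rewrite gt_eqF.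
rewrite /tilt_rV (bigD1 i0)//= (bigD1 i1)//=.
rewrite [in LHS](eq_bigr (fun i => tilt sigma (x ord0 i) (z ord0 i))); last first.
  by move=> i /andP[/negPf h0 /negPf h1]; rewrite /rotation mxE h0 h1.
rewrite mulrA [RHS]mulrAC; congr (_ * _)%R.
rewrite /tilt -!expRD; congr expR.
rewrite /rotation !mxE !eqxx (_ : (i1 == i0) = false)//.
have cs := cos2Dsin2 t.
have -> : (x ord0 i0 ^+ 2 + x ord0 i1 ^+ 2 =
    (x ord0 i0 ^+ 2 + x ord0 i1 ^+ 2) * (cos t ^+ 2 + sin t ^+ 2))%R.
  by rewrite cs mulr1.
by field.
Qed.

(** By [tilt_rV_rotation] the difference of the two sums is an alternating sum as in
    [alternating_sum_expR], times a factor that does not depend on the angle. On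
    the prism all coordinates are at most r in absolute value, so everything is
    controlled by an exponential of the l1 norm of z. *)
Lemma tilt_alternating (r M : R) (k : nat) (x z : V) :
  (0 <= r)%R -> (1 <= M)%R -> (0 < k)%N -> prism r (4 * k) 0 x ->
  (\sum_(m < 4 * k) tilt_rV sigma (rotation (m.*2%:R * (pi / (4 * k)%:R)) x) z <=
   \sum_(m < 4 * k) tilt_rV sigma (rotation (m.*2.+1%:R * (pi / (4 * k)%:R)) x) z +
   (4 * k).*2%:R * (M ^- (4 * k) *
     expR (2 * M * r / sigma ^+ 2 * \sum_i `|z ord0 i|)))%R.
Proof.
move=> r0 M1 k0 Px; set K := (4 * k)%N; set h := (pi / K%:R)%R.
have xr i : (`|x ord0 i| <= r)%R by exact: prism0_coord Px.
rewrite -lerBlDl -(sum_alternating_split (fun l => tilt_rV sigma (rotation (l%:R * h) x) z)).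
pose A : R := ((x ord0 i0 * z ord0 i0 + x ord0 i1 * z ord0 i1) / sigma ^+ 2)%R.
pose B : R := ((x ord0 i0 * z ord0 i1 - x ord0 i1 * z ord0 i0) / sigma ^+ 2)%R.
under eq_bigr do rewrite tilt_rV_rotation mulrCA.
rewrite -mulr_sumr.
set q := (_ * \prod_(_ | _) _)%R.
have q0 : (0 <= q)%R.
  by rewrite mulr_ge0 ?expR_ge0// prodr_ge0// => i _; exact: expR_ge0.
pose S01 : R := (`|z ord0 i0| + `|z ord0 i1|)%R.
pose S2 : R := (\sum_(i | (i != i0) && (i != i1)) `|z ord0 i|)%R.
have s20 : (0 < sigma ^+ 2)%R by rewrite exprn_gt0.
have xz i j : (`|x ord0 i * z ord0 j| <= r * `|z ord0 j|)%R.
  by rewrite normrM ler_wpM2r.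
have AB (a b : R) : (`|a| <= r * `|z ord0 i0| -> `|b| <= r * `|z ord0 i1| ->
    `|(a + b) / sigma ^+ 2| <= r * S01 / sigma ^+ 2)%R.
  move=> ha hb; rewrite normrM (ger0_norm (_ : 0 <= _^-1)%R) ?invr_ge0 ?(ltW s20)//.
  rewrite ler_wpM2r ?invr_ge0 ?(ltW s20)// (le_trans (ler_normD _ _))//.
  by rewrite /S01 mulrDr lerD.
have tT l : (`|A * cos (l%:R * (pi / K%:R)) + B * sin (l%:R * (pi / K%:R))| <=
    2 * (r * S01 / sigma ^+ 2))%R.
  apply: (le_trans (ler_normD _ _)); rewrite [leRHS](mulr_natl _ 2) mulr2n lerD//.
    rewrite normrM -[leRHS]mulr1 ler_pM ?cos_max//; exact: AB.
  rewrite normrM -[leRHS]mulr1 ler_pM ?sin_max// /B addrC AB// normrN; exact: xz.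
have := alternating_sum_expR M1 tT; rewrite -/A -/B => h1.
apply: (le_trans (ler_wpM2l q0 h1)).
rewrite mulrCA ler_wpM2l// mulrCA ler_wpM2l ?invr_ge0 ?exprn_ge0 ?(le_trans _ M1)//.
have qS : (q <= expR (r * S2 / sigma ^+ 2))%R.
  rewrite /q -[leRHS]mul1r ler_pM ?expR_ge0//.
  - by rewrite prodr_ge0// => i _; exact: expR_ge0.
  - rewrite -expR0 ler_expR mulNr oppr_le0 !mulr_ge0 ?invr_ge0 ?(ltW s20)//.
    by rewrite addr_ge0// sqr_ge0.
  rewrite /S2 mulr_sumr mulr_suml expR_sum; apply: ler_prod => i _.
  rewrite expR_ge0/= ler_expR ler_wpM2r ?invr_ge0 ?(ltW s20)//.
  have := xz i i; rewrite ler_norml => /andP[_ hx].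
  by have := sqr_ge0 (x ord0 i); lra.
apply: (le_trans (ler_wpM2r (expR_ge0 _) qS)).
rewrite -expRD ler_expR big_plane_split -/S01 -/S2.
have S20 : (0 <= S2)%R by rewrite sumr_ge0.
have -> : (2 * M * r / sigma ^+ 2 * (S01 + S2) =
   (2 * M - 1) * (r * S2 / sigma ^+ 2) + r * S2 / sigma ^+ 2 +
   M * (2 * (r * S01 / sigma ^+ 2)))%R by field; rewrite gt_eqF.
rewrite lerD2r lerDr mulr_ge0//; first by lra.
by rewrite !mulr_ge0 ?invr_ge0 ?(ltW s20).
Qed.

Lemma measurable_tilt_rV_pair : measurable_fun setT
  (fun xz : V * V => tilt_rV sigma xz.1 xz.2).
Proof.
apply: measurable_prod => i _; rewrite /tilt.
have m1 : measurable_fun setT (fun xz : V * V => xz.1 ord0 i).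
  exact: (measurableT_comp (measurable_coord i) measurable_fst).
have m2 : measurable_fun setT (fun xz : V * V => xz.2 ord0 i).
  exact: (measurableT_comp (measurable_coord i) measurable_snd).
apply: measurableT_comp => //; apply: measurable_funM => //.
apply: measurable_funB; first exact: measurable_funM.
by apply: measurable_funM => //; exact: measurable_funX.
Qed.

Lemma tilt_rV_ge0 n (x z : 'rV[R]_n) : (0 <= tilt_rV sigma x z)%R.
Proof. by apply: prodr_ge0 => i _; exact: expR_ge0. Qed.

Lemma onep_cos_gt0 (k : nat) : (0 < k)%N -> (0 < 1 + cos (@pi R / (4 * k)%:R))%R.
Proof.
move=> k0; set h := (pi / _)%R.
have kR : (1 <= k%:R :> R)%R by rewrite ler1n.
have pi0 := @pi_gt0 R; have h0 : (0 < h)%R by rewrite divr_gt0// ltr0n; lia.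
rewrite ltr_wpDr// ltW//; apply: cos_gt0_pihalf.
rewrite (lt_trans _ h0)/=; last by lra.
by rewrite /h natrM ltr_pdivrMr; nra.
Qed.

Section two_prisms.
Variables (r M : R) (k : nat) (G1 G2 : convex_body R d.+2).
Hypotheses (r0 : (0 <= r)%R) (M1 : (1 <= M)%R) (k0 : (0 < k)%N).
Local Notation h := (@pi R / (4 * k)%:R)%R.
Hypotheses (G1E : body G1 = prism r (4 * k) 0) (G2E : body G2 = prism r (4 * k) h).

Let indic_iff (A B : set V) a b : (A a <-> B b) -> \1_A a = \1_B b :> R.
Proof.
move=> [ab ba]; rewrite !indicE; congr (nat_of_bool _)%:R.
by apply/idP/idP => /set_mem ?; apply/mem_set; auto.
Qed.

Let prism_even (m : nat) (x : V) :
  prism r (4 * k) 0 (rotation (m.*2%:R * h) x) <-> prism r (4 * k) 0 x.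
Proof.
have -> : prism r (4 * k) 0 = prism r (4 * k) (0 + m.*2%:R * h) :> set V.
  rewrite -[LHS](@prismD R d r (4 * k) 0 m%:Z); congr prism.
  by rewrite -pmulrn -mul2n natrM; ring.
have -> : prism r (4 * k) (0 + m.*2%:R * h) x = prism r (4 * k) 0 x.
  rewrite -[in RHS](@prismD R d r (4 * k) 0 m%:Z); congr prism.
  by rewrite -pmulrn -mul2n natrM; ring.
exact: prism_rotation.
Qed.

Let prism_odd (m : nat) (x : V) :
  prism r (4 * k) h (rotation (m.*2.+1%:R * h) x) <-> prism r (4 * k) 0 x.
Proof.
have -> : (m.*2.+1%:R * h = h + m.*2%:R * h)%R by rewrite -(natr1 m.*2); ring.
rewrite rotationD -[X in prism _ _ X _]add0r.
split; first by move/prism_rotation/prism_even.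
by move/(prism_even m)/prism_rotation.
Qed.

Let volume_eq : leb G1 = leb G2.
Proof.
have vol (G : convex_body R d.+2) : leb G = \int[leb]_x (\1_(body G) x)%:E.
  by rewrite integral_indic ?setIT//; exact: measurable_body.
rewrite !vol -[RHS](lebesgue_rV_rotation_iter 1 (onep_cos_gt0 k0)); last 2 first.
- by apply/measurable_EFinP; apply: measurable_indic; exact: measurable_body.
- by move=> x; rewrite lee_fin.
apply: eq_integral => x _; congr EFin; apply: indic_iff; rewrite G1E G2E.
by split => /(prism_odd 0).
Qed.

Let density_even m x :
  uniform_density G1 (rotation (m.*2%:R * h) x) = uniform_density G1 x.
Proof. by congr *%R; apply: indic_iff; rewrite G1E; exact: prism_even. Qed.

Let density_odd m x :
  uniform_density G2 (rotation (m.*2.+1%:R * h) x) = uniform_density G1 x.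
Proof.
rewrite /uniform_density volume_eq; congr *%R; apply: indic_iff.
by rewrite G1E G2E; exact: prism_odd.
Qed.

(** Rotating x by even multiples of h does not change the mean over G1, and by odd
    multiples it gives the mean over G2. The bound follows by averaging
    [tilt_alternating] over the 4k rotations of each kind. *)
Lemma mixture_tilt_comparison (z : V) :
  \int[uniform_body G1]_x (tilt_rV sigma x z)%:E <=
  \int[uniform_body G2]_x (tilt_rV sigma x z)%:E +
  (2 * (M ^- (4 * k) * expR (2 * M * r / sigma ^+ 2 * \sum_i `|z ord0 i|)))%:E.
Proof.
have M0 : (0 <= M)%R by exact: le_trans ler01 M1.
have mt : measurable_fun setT (fun x => tilt_rV sigma x z).
  exact: (measurable_fun_pair1 z measurable_tilt_rV_pair).
have mEt : measurable_fun setT (fun x => (tilt_rV sigma x z)%:E).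
  exact/measurable_EFinP.
have t0 x : 0 <= (tilt_rV sigma x z)%:E by rewrite lee_fin tilt_rV_ge0.
have mtp G : measurable_fun setT
    (fun x => (tilt_rV sigma x z)%:E * (uniform_density G x)%:E).
  apply: (emeasurable_funM mEt); apply/measurable_EFinP.
  exact: measurable_uniform_density.
have tp0 G x : 0 <= (tilt_rV sigma x z)%:E * (uniform_density G x)%:E.
  by apply: mule_ge0; [exact: t0|rewrite lee_fin; exact: uniform_density_ge0].
apply: (@averaging_comparison _ _ _ leb (uniform_density G1)
  (fun m x => tilt_rV sigma (rotation (m.*2%:R * h)%R x) z)
  (fun m x => tilt_rV sigma (rotation (m.*2.+1%:R * h)%R x) z)
  _ _ _ _ _ _ _ (4 * k)).
- exact: measurable_uniform_density.
- exact: uniform_density_ge0.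
- rewrite (_ : 1 = \int[uniform_body G1]_x cst 1 x).
    rewrite (ge0_integral_uniform_body _ (measurable_cst 1) (fun=> lee01)).
    by apply: eq_integral => x _; rewrite mul1e.
  rewrite integral_cst ?mul1e; last exact: measurableT.
  exact/esym/probability_setT.
- move=> m; exact: (measurableT_comp mt (measurable_plane_map _ _ _ _)).
- by move=> m x; exact: tilt_rV_ge0.
- move=> m; exact: (measurableT_comp mt (measurable_plane_map _ _ _ _)).
- by move=> m x; exact: tilt_rV_ge0.
- by rewrite muln_gt0.
- apply: mulr_ge0; first exact: ler0n.
  by apply: mulr_ge0; [rewrite invr_ge0; exact: exprn_ge0|exact: expR_ge0].
- move=> m; rewrite (ge0_integral_uniform_body _ mEt t0).
  rewrite -[RHS](lebesgue_rV_rotation_iter m.*2 (onep_cos_gt0 k0) (mtp G1) (tp0 G1)).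
  by apply: eq_integral => x _; rewrite density_even EFinM.
- move=> m; rewrite (ge0_integral_uniform_body _ mEt t0).
  rewrite -[RHS](lebesgue_rV_rotation_iter m.*2.+1 (onep_cos_gt0 k0) (mtp G2) (tp0 G2)).
  by apply: eq_integral => x _; rewrite density_odd EFinM.
- move=> x px; have G1x : body G1 x.
    apply: contrapT => nG1x; move/eqP: px; apply.
    rewrite /uniform_density indicE (memNset nG1x); exact: mulr0.
  apply: (le_trans (tilt_alternating z r0 M1 k0 _)); first by rewrite -G1E.
  by rewrite lerD2l [leRHS]mulrA -natrM muln2.
Qed.
End two_prisms.
End one_observation.

(** * From one observation to a sample *)

Section hybrid.
Local Open Scope ereal_scope.
Context (R : realType) (d : nat).
Local Notation V := 'rV[R]_d.
Implicit Types (mu gam : probability V R).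

Let madd : measurable_fun setT (fun xe : V * V => (xe.1 + xe.2)%R).
Proof.
apply: measurable_fun_rV => i; under eq_fun do rewrite mxE.
by apply: measurable_funD; apply: (measurableT_comp (measurable_coord i)).
Qed.

Let obs_cons n x e xs es :
  observation (tuple_cons (x, xs), tuple_cons (e, es)) =
  tuple_cons ((x + e)%R : V, observation (xs, es)) :> n.+1.-tuple V.
Proof.
apply/eq_from_tnth => i; rewrite tnth_mktuple.
by case: (unliftP ord0 i) => [j ->|->]; rewrite ?tnthS ?tnth0 ?tnth_mktuple.
Qed.

(** The first observation is independent of the others. *)
Lemma ge0_integral_observationS mu gam n (f : n.+1.-tuple V -> \bar R) :
  measurable_fun setT f -> (forall y, 0 <= f y) ->
  \int[iid mu n.+1 \x iid gam n.+1]_xe f (observation xe) =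
  \int[mu]_x \int[gam]_e \int[iid mu n \x iid gam n]_xe
    f (tuple_cons ((x + e)%R, observation xe)).
Proof.
move=> mf f0.
have mobs k : measurable_fun setT (@observation R d k) by [].
have mcons k : measurable_fun setT (@tuple_cons _ V k) by [].
have mfo := measurableT_comp mf (mobs n.+1).
rewrite fubini_tonelli1//.
rewrite /fubini_F/= ge0_integral_tuple_measureS//; last 2 first.
- apply: (@measurable_fun_fubini_tonelli_F _ _ _ _ R (iid gam n.+1)
    (f \o @observation R d n.+1)) => //.
  by move=> z; exact: f0.
- by move=> z; apply: integral_ge0 => es _; exact: f0.
apply: eq_integral => x _.
pose H (z : (n.-tuple V * V) * n.-tuple V) :=
   f (tuple_cons ((x + z.1.2)%R, observation (z.1.1, z.2))).
have mH : measurable_fun setT H.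
  apply: (measurableT_comp mf).
  apply: (measurable_cons (f := fun z : (n.-tuple V * V) * n.-tuple V => (x + z.1.2)%R)
    (g := fun z => observation (z.1.1, z.2))).
    exact: (measurableT_comp madd (measurable_fun_pair (measurable_cst x)
      (measurableT_comp measurable_snd measurable_fst))).
  apply: (measurableT_comp (mobs n)); apply: measurable_fun_pair => //.
  exact: (measurableT_comp measurable_fst measurable_fst).
have H0 z : 0 <= H z by exact: f0.
have mHF : measurable_fun setT (fun z => \int[iid gam n]_es H (z, es)).
  exact: (@measurable_fun_fubini_tonelli_F _ _ _ _ R (iid gam n) H).
transitivity (\int[iid mu n]_xs \int[gam]_e \int[iid gam n]_es H ((xs, e), es)).
  apply: eq_integral => xs _; rewrite ge0_integral_tuple_measureS//.
    apply: eq_integral => e _; apply: eq_integral => es _.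
    by rewrite obs_cons.
  exact: (measurable_fun_pair2 (tuple_cons (x, xs)) mfo).
rewrite (fubini_tonelli (fun z => \int[iid gam n]_es H (z, es)))//; last first.
  by move=> z; exact: integral_ge0.
apply: eq_integral => e _; rewrite fubini_tonelli1//.
apply: (measurableT_comp mf).
apply: (measurable_cons (f := cst (x + e)%R) (g := @observation R d n)) => //.
Qed.

Lemma ge0_integral_observation0 mu gam (f : 0.-tuple V -> \bar R) :
  measurable_fun setT f -> (forall y, 0 <= f y) ->
  \int[iid mu 0 \x iid gam 0]_xe f (observation xe) = f [tuple].
Proof.
move=> mf f0; under eq_integral do rewrite tuple0.
rewrite integral_cst// -[RHS]mule1; congr (_ * _).
exact: (@probability_setT _ _ _ (iid mu 0 \x iid gam 0)).
Qed.

(** Induction on n: the law of the first observation is replaced once the others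
    have been integrated out, at a cost of delta. Test functions with values in
    [0, 1], rather than events, are what the induction requires, since
    integrating out observations turns events into such functions. *)
Lemma observation_tensorization mu1 mu2 gam (delta : R) n :
  (0 <= delta)%R ->
  (forall g : V -> \bar R, measurable_fun setT g -> (forall y, 0 <= g y <= 1) ->
    \int[mu1]_x \int[gam]_e g (x + e)%R <=
    \int[mu2]_x \int[gam]_e g (x + e)%R + delta%:E) ->
  forall f : n.-tuple V -> \bar R, measurable_fun setT f ->
    (forall y, 0 <= f y <= 1) ->
  \int[iid mu1 n \x iid gam n]_xe f (observation xe) <=
  \int[iid mu2 n \x iid gam n]_xe f (observation xe) + (n%:R * delta)%:E.
Proof.
move=> d0 H; elim: n => [|n IHn] f mf f01.
  have f0 y : 0 <= f y by have /andP[] := f01 y.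
  by rewrite !ge0_integral_observation0// mul0r adde0.
have f0 y : 0 <= f y by have /andP[] := f01 y.
rewrite !ge0_integral_observationS//.
have mobs k : measurable_fun setT (@observation R d k) by [].
pose F (z : V * (n.-tuple V * n.-tuple V)) := f (tuple_cons (z.1, observation z.2)).
have mF : measurable_fun setT F.
  apply: (measurableT_comp mf).
  apply: (measurable_cons (f := fst) (g := fun z => observation z.2)) => //.
  exact: (measurableT_comp (mobs n)).
have mFi mu : measurable_fun setT (fun y => \int[iid mu n \x iid gam n]_xe F (y, xe)).
  pose P : probability _ R := (iid mu n \x iid gam n).
  by apply: (@measurable_fun_fubini_tonelli_F _ _ _ _ R P F) => // z; exact: f0.
pose g y := \int[iid mu2 n \x iid gam n]_xe F (y, xe).
have g0 y : 0 <= g y by apply: integral_ge0 => z _; exact: f0.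
have g01 y : 0 <= g y <= 1.
  rewrite g0/=; apply: (@le_trans _ _ (\int[iid mu2 n \x iid gam n]_xe cst 1 xe)).
    apply: ge0_le_integralT => //.
    - exact: (measurable_fun_pair2 y mF).
    - by move=> z; exact: f0.
    - by move=> z; have /andP[] := f01 (tuple_cons (y, observation z)).
  by rewrite integral_cst// mul1e probability_le1.
have mg : measurable_fun setT g by exact: mFi.
have mgadd : measurable_fun setT (fun xe : V * V => g (xe.1 + xe.2)%R).
  exact: (measurableT_comp mg madd).
have mgx x : measurable_fun setT (fun e : V => g (x + e)%R).
  exact: (measurable_fun_pair2 x mgadd).
have c0 : 0 <= (n%:R * delta)%:E by rewrite lee_fin mulr_ge0.
have mgi : measurable_fun setT (fun x : V => \int[gam]_e g (x + e)%R).
  exact: (@measurable_fun_fubini_tonelli_F _ _ _ _ R gam (fun xe : V * V => g (xe.1 + xe.2)%R)).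
have gi0 x : 0 <= \int[gam]_e g (x + e)%R by exact: integral_ge0.
have cstE (P : probability V R) (c : R) : \int[P]_x (cst c%:E) x = c%:E.
  rewrite integral_cst// -[RHS]mule1; congr (_ * _).
  exact: (@probability_setT _ _ _ P).
apply: (@le_trans _ _ (\int[mu1]_x \int[gam]_e (g (x + e)%R + (n%:R * delta)%:E))).
  pose F1 (z : V * V) := \int[iid mu1 n \x iid gam n]_xe F ((z.1 + z.2)%R, xe).
  have mF1 : measurable_fun setT F1 by exact: (measurableT_comp (mFi mu1) madd).
  have F10 z : 0 <= F1 z by apply: integral_ge0 => w _; exact: f0.
  pose F2 (z : V * V) := g (z.1 + z.2)%R + (n%:R * delta)%:E.
  have mF2 : measurable_fun setT F2.
    by apply: (emeasurable_funD mgadd); exact: measurable_cst.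
  have F20 z : 0 <= F2 z by exact: (adde_ge0 (g0 _) c0).
  apply: ge0_le_integralT.
  - exact: (@measurable_fun_fubini_tonelli_F _ _ _ _ R gam F1).
  - exact: (@measurable_fun_fubini_tonelli_F _ _ _ _ R gam F2).
  - by move=> x; apply: integral_ge0 => e _; exact: (F10 (x, e)).
  move=> x; apply: ge0_le_integralT.
  - exact: (measurable_fun_pair2 x mF1).
  - exact: (measurable_fun_pair2 x mF2).
  - by move=> e; exact: (F10 (x, e)).
  move=> e; apply: (IHn (fun t => f (tuple_cons ((x + e)%R : V, t)))).
    apply: (measurableT_comp mf).
    exact: (measurable_cons (f := cst (x + e)%R) (g := id)).
  by move=> y; exact: f01.
have -> : \int[mu1]_x \int[gam]_e (g (x + e)%R + (n%:R * delta)%:E) =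
    \int[mu1]_x \int[gam]_e g (x + e)%R + (n%:R * delta)%:E.
  transitivity (\int[mu1]_x (\int[gam]_e g (x + e)%R + (n%:R * delta)%:E)).
    apply: eq_integral => x _; rewrite ge0_integralD//.
    by congr (_ + _); exact: cstE.
  by rewrite ge0_integralD//; congr (_ + _); exact: cstE.
apply: (le_trans (leeD2r _ (H g mg g01))).
by rewrite -addeA -EFinD -natr1 mulrDl mul1r [(delta + _)%R]addrC.
Qed.
End hybrid.

Section comparison.
Context (R : realType) (d : nat).
Local Notation V := 'rV[R]_d.+2.
Local Open Scope ereal_scope.
Variable (sigma : R).
Hypothesis sigma0 : (0 < sigma)%R.
Local Notation gam := (@gaussian_rV R d.+2 sigma).

Let mtilt z : measurable_fun setT (fun x : V => (tilt_rV sigma x z)%:E).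
Proof.
have h := @measurable_tilt_rV_pair R d sigma.
have mt : measurable_fun setT (fun x : V => tilt_rV sigma x z).
  exact: (measurable_fun_pair1 z h).
by apply/measurable_EFinP.
Qed.

Let tilt0 (x z : V) : 0 <= (tilt_rV sigma x z)%:E.
Proof. by rewrite lee_fin tilt_rV_ge0. Qed.

Let mtilt_pair : measurable_fun setT (fun xz : V * V => (tilt_rV sigma xz.1 xz.2)%:E).
Proof. by apply/measurable_EFinP; exact: measurable_tilt_rV_pair. Qed.

Let mmix (mu : probability V R) :
  measurable_fun setT (fun z : V => \int[mu]_x (tilt_rV sigma x z)%:E).
Proof.
exact: (@measurable_fun_fubini_tonelli_G _ _ V V R mu
  (fun xz : V * V => (tilt_rV sigma xz.1 xz.2)%:E) mtilt_pair (fun xz => tilt0 _ _)).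
Qed.

(** The law of one observation has a density with respect to the law of the noise,
    which is the mean of the tilts. *)
Lemma ge0_integral_gaussian_mixture (mu : probability V R) (g : V -> \bar R) :
  measurable_fun setT g -> (forall y, 0 <= g y) ->
  \int[mu]_x \int[gam]_e g (x + e)%R =
  \int[gam]_z (g z * \int[mu]_x (tilt_rV sigma x z)%:E).
Proof.
move=> mg g0.
pose F (xz : V * V) := g xz.2 * (tilt_rV sigma xz.1 xz.2)%:E.
have mF : measurable_fun setT F.
  exact: (emeasurable_funM (measurableT_comp mg measurable_snd) mtilt_pair).
have F0 xz : 0 <= F xz by apply: mule_ge0; [exact: g0|exact: tilt0].
transitivity (\int[mu]_x \int[gam]_z F (x, z)).
  by apply: eq_integral => x _; rewrite (ge0_integral_gaussian_translation sigma0 x mg g0).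
rewrite (fubini_tonelli F mF F0); apply: eq_integral => z _.
by rewrite /F/= ge0_integralZl.
Qed.

(** [mixture_tilt_comparison] integrated against the law of the noise; the factor
    that involves z is integrable by [gaussian_exp_moment]. *)
Lemma one_observation_comparison (r M : R) (k : nat) (G1 G2 : convex_body R d.+2)
    (g : V -> \bar R) :
  (0 <= r)%R -> (1 <= M)%R -> (0 < k)%N ->
  body G1 = prism r (4 * k) 0 -> body G2 = prism r (4 * k) (pi / (4 * k)%:R) ->
  measurable_fun setT g -> (forall y, 0 <= g y <= 1) ->
  \int[uniform_body G1]_x \int[gam]_e g (x + e)%R <=
  \int[uniform_body G2]_x \int[gam]_e g (x + e)%R +
  (2 * (M ^- (4 * k) *
    (2 * expR ((2 * M * r / sigma ^+ 2) ^+ 2 * sigma ^+ 2 / 2)) ^+ d.+2))%:E.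
Proof.
move=> r0 M1 k0 G1E G2E mg g01.
have g0 y : 0 <= g y by have /andP[] := g01 y.
have g1 y : g y <= 1 by have /andP[] := g01 y.
have mixE (G : convex_body R d.+2) := ge0_integral_gaussian_mixture (uniform_body G) mg g0.
rewrite [leLHS](mixE G1) [X in _ <= X + _](mixE G2).
set b : R := (2 * M * r / sigma ^+ 2)%R.
have M0 : (0 <= M)%R by exact: le_trans ler01 M1.
have Mk0 : (0 <= 2 * M ^- (4 * k))%R.
  by apply: mulr_ge0; [exact: ler0n|rewrite invr_ge0; exact: exprn_ge0].
pose E (z : V) := (expR (b * \sum_i `|z ord0 i|))%:E : \bar R.
have E0 z : 0 <= E z by rewrite lee_fin expR_ge0.
have mE : measurable_fun setT E.
  apply/measurable_EFinP; apply: measurableT_comp; first exact: measurable_expR.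
  apply: measurable_funM; first exact: measurable_cst.
  apply: measurable_sum => i; apply: measurableT_comp; first exact: normr_measurable.
  exact: measurable_coord.
have mW2 := mmix (uniform_body G2); have mW1 := mmix (uniform_body G1).
have W0 (mu : probability V R) z : 0 <= \int[mu]_x (tilt_rV sigma x z)%:E.
  by apply: integral_ge0 => x _; exact: tilt0.
have mcE : measurable_fun setT (fun z => (2 * M ^- (4 * k))%:E * E z).
  exact: (emeasurable_funM (measurable_cst _) mE).
have cE0 z : 0 <= (2 * M ^- (4 * k))%:E * E z by apply: mule_ge0; [rewrite lee_fin|exact: E0].
have mgW2 := emeasurable_funM mg mW2.
have gW0 z : 0 <= g z * \int[uniform_body G2]_x (tilt_rV sigma x z)%:E.
  by apply: mule_ge0; [exact: g0|exact: W0].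
apply: (@le_trans _ _ (\int[gam]_z (g z * \int[uniform_body G2]_x (tilt_rV sigma x z)%:E +
    (2 * M ^- (4 * k))%:E * E z))).
  apply: ge0_le_integralT.
  - exact: (emeasurable_funM mg mW1).
  - exact: emeasurable_funD.
  - by move=> z; apply: mule_ge0; [exact: g0|exact: W0].
  move=> z; have := mixture_tilt_comparison sigma0 r0 M1 k0 G1E G2E z.
  move=> /(lee_wpmul2l (g0 z)) /le_trans; apply.
  rewrite ge0_muleDr; [|exact: W0|]; last first.
    by rewrite mulrA EFinM; exact: cE0.
  apply: leeD2l; rewrite mulrA EFinM -/b -/(E z).
  by rewrite -[leRHS]mul1e; apply: lee_wpmul2r; [exact: cE0|exact: g1].
rewrite (ge0_integralD _ measurableT (fun z _ => gW0 z) mgW2 (fun z _ => cE0 z) mcE).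
apply: leeD2l.
rewrite (ge0_integralZl_EFin _ measurableT (fun z _ => E0 z) mE Mk0).
rewrite mulrA [leRHS]EFinM; apply: lee_wpmul2l; first by rewrite lee_fin.
exact: gaussian_exp_moment.
Qed.

Lemma observation_lawE n (G : convex_body R d.+2) (A : set (n.-tuple V)) :
  measurable A ->
  observation_law sigma n G A =
  \int[iid (uniform_body G) n \x iid (@gaussian_rV R d.+2 sigma) n]_xe
    (\1_A (observation xe))%:E.
Proof.
move=> mA.
have mobs : measurable_fun setT (@observation R d.+2 n) by [].
have mO : measurable (@observation R d.+2 n @^-1` A).
  by rewrite -[X in measurable X]setTI; exact: mobs.
rewrite -[LHS](_ : \int[iid (uniform_body G) n \x iid (@gaussian_rV R d.+2 sigma) n]_xe
   (\1_(@observation R d.+2 n @^-1` A) xe)%:E = _)//.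
by rewrite integral_indic// setIT.
Qed.

Lemma observation_law_comparison n (r M : R) (k : nat) (G1 G2 : convex_body R d.+2)
    (A : set (n.-tuple V)) :
  (0 <= r)%R -> (1 <= M)%R -> (0 < k)%N ->
  body G1 = prism r (4 * k) 0 -> body G2 = prism r (4 * k) (pi / (4 * k)%:R) ->
  measurable A ->
  observation_law sigma n G1 A <= observation_law sigma n G2 A +
  (n%:R * (2 * (M ^- (4 * k) *
    (2 * expR ((2 * M * r / sigma ^+ 2) ^+ 2 * sigma ^+ 2 / 2)) ^+ d.+2)))%:E.
Proof.
move=> r0 M1 k0 G1E G2E mA.
rewrite [leLHS](observation_lawE _ mA) [X in _ <= X + _](observation_lawE _ mA).
apply: (@observation_tensorization R d.+2 (uniform_body G1) (uniform_body G2)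
  (@gaussian_rV R d.+2 sigma) _ n _ _ (fun y => (\1_A y)%:E)).
- apply: mulr_ge0; first exact: ler0n.
  apply: mulr_ge0; first by rewrite invr_ge0 exprn_ge0// (le_trans ler01 M1).
  by apply: exprn_ge0; apply: mulr_ge0; [exact: ler0n|exact: expR_ge0].
- by move=> g mg g01; exact: one_observation_comparison.
- by apply/measurable_EFinP; exact: measurable_indic.
- by move=> y; rewrite !lee_fin indicE ler0n lern1 leq_b1.
Qed.
End comparison.

Section le_cam.
Local Open Scope ereal_scope.

(** If A1 has small probability under P1, its complement is likely under P1, hence
    also under P2 up to 1 / 2, and this complement is contained in A2. *)
Lemma le_cam_two_point dT (T : measurableType dT) (R : realType)
    (P1 P2 : probability T R) (A1 A2 : set T) :
  measurable A1 -> measurable A2 -> (forall y, A1 y \/ A2 y) ->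
  P1 (~` A1) <= P2 (~` A1) + (2^-1)%:E ->
  (4^-1)%:E <= P1 A1 \/ (4^-1)%:E <= P2 A2.
Proof.
move=> mA1 mA2 cov.
have sub : P2 (~` A1) <= P2 A2.
  apply: le_measure; rewrite ?inE//; first exact: measurableC.
  by move=> y nA1; have [|//] := cov y.
rewrite probability_setC// => h.
have := probability_le1 P1 mA1; have := measure_ge0 P1 A1.
have := measure_ge0 P2 A2; have := probability_le1 P2 mA2.
move: h sub; have : P2 (~` A1) \is a fin_num.
  by rewrite ge0_fin_numE// (le_lt_trans (probability_le1 _ _)) ?ltry//; exact: measurableC.
case: (P1 A1) => [a| |]//; case: (P2 (~` A1)) => [b| |]//; case: (P2 A2) => [c| |]//.
move=> _; rewrite -EFinB -EFinD !lee_fin => ????? ?.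
by have [|] := lerP 4^-1 a; [left|right; lra].
Qed.
End le_cam.

(** * The lower bound *)

Section final.
Context (R : realType).

(** The number of sides will be 4k: it has to exceed ln n by a constant for the
    samples to be indistinguishable, and to remain of order ln n for the bodies to
    be separated. *)
Lemma exists_side_count (L x : R) : 0 <= L -> ln 2 <= x ->
  exists2 k : nat, (0 < k)%N &
    x + L <= k%:R /\ k%:R <= (1 + (L + 1) / ln 2) * x.
Proof.
move=> L0 x2; have ln20 : 0 < ln 2 :> R by rewrite ln_gt0// ltr1n.
have xL0 : 0 <= x + L by rewrite addr_ge0// (le_trans (ltW ln20)).
exists (Num.truncn (x + L)).+1 => //; split; first exact/ltW/truncnS_gt.
rewrite -natr1; have : (Num.truncn (x + L))%:R <= x + L by rewrite truncn_le.
have : L + 1 <= (L + 1) / ln 2 * x.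
  by rewrite mulrAC ler_pdivlMr// ler_wpM2l// addr_ge0.
lra.
Qed.

(** Since tau < 1, the exponent - 2 / tau is below - 2. The discrepancy is absorbed
    by a constant as ln n stays away from 0 for n >= 2. *)
Lemma powR_log_rate (tau x : R) : 0 < tau < 1 -> ln 2 <= x ->
  x `^ (- (2 / tau)) <= (ln 2 `^ (2 / tau - 2) * x ^+ 2)^-1.
Proof.
move=> /andP[t0 t1] x2; have ln20 : 0 < ln 2 :> R by rewrite ln_gt0// ltr1n.
have x0 : 0 < x by exact: lt_le_trans x2.
have e0 : 0 <= 2 / tau - 2 by rewrite subr_ge0 ler_pdivlMr//; lra.
rewrite powRN lef_pV2 ?posrE ?mulr_gt0 ?powR_gt0 ?exprn_gt0//.
have -> : x `^ (2 / tau) = x `^ (2 / tau - 2) * x ^+ 2.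
  rewrite -(powR_mulrn _ (ltW x0)) -powRD ?subrK//.
  by apply/implyP => _; rewrite gt_eqF.
rewrite ler_pM2r ?exprn_gt0//.
by apply: ge0_ler_powR => //; rewrite nnegrE ltW.
Qed.

Lemma hausdorff_dist_ge0 n (A B : set 'rV[R]_n) : (0 <= hausdorff_dist A B)%E.
Proof.
by apply: le_ereal_inf_tmp => _ [e [e0 _ _] <-]; rewrite lee_fin ltW.
Qed.

Lemma prisms_separated d (r t : R) (k : nat) (S : set 'rV[R]_d.+2) :
  0 < r -> (0 < k)%N -> t < r * cos 1 ^+ 2 / (16 * k%:R ^+ 2) ->
  (t%:E < hausdorff_dist (prism r (4 * k) 0) S)%E \/
  (t%:E < hausdorff_dist (prism r (4 * k) (pi / (4 * k)%:R)) S)%E.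
Proof.
move=> r0 k0 tk; have K2 : (2 < 4 * k)%N by lia.
have [h1|] := ltP t%:E (hausdorff_dist (prism r (4 * k) 0) S); first by left.
have [h2|] := ltP t%:E (hausdorff_dist (prism r (4 * k) (pi / (4 * k)%:R)) S); first by right.
move=> h2 h1; exfalso; have [v v1 v2] := @prism_vertex R d r _ r0 K2.
have := hausdorff_two_point v1 v2 h1 h2; apply/negP; rewrite -ltNge.
have kR : 0 < k%:R :> R by rewrite ltr0n.
have := @onem_cos_lower R _ K2; rewrite -(ler_pM2l r0); apply: lt_le_trans.
rewrite natrM exprMn.
have -> : r * (2 * cos 1 ^+ 2 / (4%:R ^+ 2 * k%:R ^+ 2)) =
    2 * (r * cos 1 ^+ 2 / (16 * k%:R ^+ 2)) by field; rewrite gt_eqF.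
by rewrite ltr_pM2l.
Qed.

Lemma expectation_ge_tail dT (T : measurableType dT) (P : probability T R)
    (f : T -> \bar R) (t p : R) : 0 <= t ->
  measurable_fun setT f -> (forall y, 0 <= f y)%E ->
  (p%:E <= P [set y | t%:E < f y])%E -> ((t * p)%:E <= \int[P]_y f y)%E.
Proof.
move=> t0 mf f0 pP; set A := [set y | _] in pP.
have mA : measurable A.
  by rewrite /A -[X in measurable X]setTI; exact: emeasurable_fun_o_infty.
have mI : measurable_fun setT (fun y => (\1_A y)%:E : \bar R).
  by apply/measurable_EFinP; exact: measurable_indic.
apply: (@le_trans _ _ (\int[P]_y (t%:E * (\1_A y)%:E))%E).
  rewrite (ge0_integralZl_EFin _ measurableT _ mI t0)//.
  rewrite integral_indic// setIT EFinM; exact: lee_wpmul2l.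
apply: ge0_le_integralT => //.
- exact: emeasurable_funM.
- by move=> y; rewrite -EFinM lee_fin mulr_ge0.
move=> y; rewrite indicE; case: (boolP (y \in A)) => [/set_mem yA|_].
  by rewrite mule1 ltW.
by rewrite mule0.
Qed.
End final.

Theorem theorem4 (R : realType) (d : nat) (sigma r rho tau : R) :
  (2 <= d)%N -> 0 < sigma -> 0 < r -> 0 < rho ->
  2 * Num.sqrt d%:R <= rho / r -> 0 < tau < 1 ->
  let K : set (convex_body R d) := bodies_between r rho in
  exists c C : R, [/\ 0 < c, 0 < C & forall n : nat, (2 <= n)%N ->
    (C%:E <= ereal_inf [set
       ereal_sup [set observation_law sigma n G
           [set y : n.-tuple 'rV[R]_d |
              ((c * ln n%:R `^ (- (2 / tau)))%:E <
               hausdorff_dist G (Ghat y))%E] | G in K]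
       | Ghat in estimators K n])%E /\
    ((C * ln n%:R `^ (- (2 / tau)))%:E <= ereal_inf [set
       ereal_sup [set (\int[observation_law sigma n G]_y
           hausdorff_dist G (Ghat y))%E | G in K]
       | Ghat in estimators K n])%E].
Proof.
case: d => [|[|d]]// _ s0 r0 rho0 rhor tau01 K.
have ln20 : 0 < ln 2 :> R by rewrite ln_gt0// ltr1n.
(* the constant of [observation_law_comparison] for M = e *)
pose D : R := (2 * expR ((2 * expR 1 * r / sigma ^+ 2) ^+ 2 * sigma ^+ 2 / 2)) ^+ d.+2.
have D0 : 0 < D by rewrite exprn_gt0// mulr_gt0// expR_gt0.
(* 4k >= ln n + L makes n * (2 D e^-(4k)) at most 1 / 2 *)
pose L : R := `|ln (4 * D)|.
pose B : R := 1 + (L + 1) / ln 2.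
have L0 : 0 <= L by exact: normr_ge0.
have B0 : 0 < B by rewrite addr_gt0// divr_gt0// ltr_wpDl.
(* The error level is half of the one allowed by [prisms_separated], in which
   k <= B ln n; the power of ln 2 comes from [powR_log_rate]. *)
pose c := r * cos 1 ^+ 2 * ln 2 `^ (2 / tau - 2) / (32 * B ^+ 2).
have cos10 : 0 < cos 1 ^+ 2 :> R by rewrite exprn_gt0// cos1_gt0.
have c0 : 0 < c.
  apply: divr_gt0; last by apply: mulr_gt0 => //; exact: exprn_gt0.
  by apply: mulr_gt0; [exact: mulr_gt0|exact: powR_gt0].
(* Markov's inequality then turns the bound in probability into one in mean. *)
suff main n (Ghat : n.-tuple 'rV[R]_d.+2 -> set 'rV[R]_d.+2) :
    (2 <= n)%N -> estimators K n Ghat ->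
    exists2 G, K G & ((4^-1)%:E <= observation_law sigma n G
      [set y | (c * ln n%:R `^ (- (2 / tau)))%:E < hausdorff_dist G (Ghat y)])%E.
  exists c, (Num.min 4^-1 (c * 4^-1)); split => //.
    by rewrite lt_min invr_gt0 ltr0n/= mulr_gt0// invr_gt0.
  move=> n n2; split; apply: le_ereal_inf_tmp => _ [Ghat est <-].
    have [G KG hG] := main n Ghat n2 est.
    apply: (@le_trans _ _ (4^-1)%:E); first by rewrite lee_fin ge_min lexx.
    by apply: (le_trans hG); apply: ereal_sup_ubound; exists G.
  have [G KG hG] := main n Ghat n2 est.
  apply: (@le_trans _ _ (c * ln n%:R `^ (- (2 / tau)) * 4^-1)%:E).
    rewrite lee_fin [leRHS]mulrAC ler_wpM2r ?powR_ge0//.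
    by rewrite ge_min lexx orbT.
  apply: le_trans (ereal_sup_ubound _); last by exists G.
  apply: expectation_ge_tail hG.
  - by rewrite mulr_ge0 ?powR_ge0 ?ltW.
  - exact: est.
  - by move=> y; exact: hausdorff_dist_ge0.
move=> n2 est.
have lnn : ln 2 <= ln n%:R :> R.
  have n0 : 0 < n%:R :> R by rewrite ltr0n (ltn_trans _ n2).
  by rewrite ler_ln ?posrE ?ler_nat.
have [k k0 [kge kle]] := exists_side_count L0 lnn.
have [G1 G1E] := @exists_prism_body R d r k 0 r0 k0.
have [G2 G2E] := @exists_prism_body R d r k (pi / (4 * k)%:R) r0 k0.
have KG (G : convex_body R d.+2) t : body G = prism r (4 * k) t -> K G.
  move=> GE; rewrite /K/bodies_between/= GE; split.
    by exists 0; exact: eball_prism.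
  move=> x /(prism_sub_eball k0); rewrite /eball/= => /le_trans; apply.
  have s20 : 0 <= Num.sqrt d.+2%:R :> R by [].
  by move: rhor; rewrite ler_pdivlMr//; nra.
set t := c * _.
have sep : t < r * cos 1 ^+ 2 / (16 * k%:R ^+ 2).
  have x0 : 0 < ln n%:R :> R by exact: lt_le_trans lnn.
  apply: (@le_lt_trans _ _ (r * cos 1 ^+ 2 / (32 * (B * ln n%:R) ^+ 2))).
    rewrite /t; apply: (@le_trans _ _ (c * (ln 2 `^ (2 / tau - 2) * ln n%:R ^+ 2)^-1)).
      by rewrite ler_pM2l//; exact: powR_log_rate.
    rewrite le_eqVlt; apply/orP; left; apply/eqP; rewrite /c; field.
    by rewrite !gt_eqF// powR_gt0.
  have kR : 0 < k%:R :> R by rewrite ltr0n.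
  have rc0 : 0 < r * cos 1 ^+ 2 by exact: mulr_gt0.
  have kx : k%:R ^+ 2 <= (B * ln n%:R) ^+ 2.
    by apply: lerXn2r; rewrite ?nnegrE ?mulr_ge0// ltW.
  have k20 : 0 < k%:R ^+ 2 :> R by exact: exprn_gt0.
  rewrite (ltr_pM2l rc0) ltf_pV2 ?posrE; [lra|lra|exact: mulr_gt0].
have mE G : K G -> measurable [set y | (t%:E < hausdorff_dist G (Ghat y))%E].
  move=> KGG; rewrite -[X in measurable X]setTI.
  exact: (emeasurable_fun_o_infty _ (est G KGG)).
have K1 := KG _ _ G1E; have K2 := KG _ _ G2E.
have cov y : (t%:E < hausdorff_dist G1 (Ghat y))%E \/ (t%:E < hausdorff_dist G2 (Ghat y))%E.
  by rewrite G1E G2E; exact: (prisms_separated (Ghat y) r0 k0 sep).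
have nD : n%:R * (2 * (expR 1 ^- (4 * k) * D)) <= 2^-1.
  have n0 : 0 < n%:R :> R by rewrite ltr0n (ltn_trans _ n2).
  have : 4 * D * n%:R <= expR 1 ^+ (4 * k).
    have D40 : 0 < 4 * D by exact: mulr_gt0.
    have DnP : 4 * D * n%:R \is Num.pos by rewrite posrE; exact: mulr_gt0.
    rewrite -expRM_natl mulr1 -(lnK DnP) ler_expR lnM ?posrE//.
    have : ln (4 * D) <= L by exact: ler_norm.
    have : k%:R <= (4 * k)%:R :> R by rewrite ler_nat leq_pmull.
    lra.
  have e0 : 0 < expR 1 ^+ (4 * k) :> R by rewrite exprn_gt0// expR_gt0.
  set e := _ ^+ _ in e0 *; move=> h.
  have -> : n%:R * (2 * (e^-1 * D)) = (4 * D * n%:R) / e / 2 by field; rewrite gt_eqF.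
  by rewrite ler_pdivrMr// mulVf// ler_pdivrMr// mul1r.
have cmp : (observation_law sigma n G1 (~` [set y | t%:E < hausdorff_dist G1 (Ghat y)]) <=
    observation_law sigma n G2 (~` [set y | t%:E < hausdorff_dist G1 (Ghat y)]) + (2^-1)%:E)%E.
  have nDE : ((n%:R * (2 * (expR 1 ^- (4 * k) * D)))%:E <= (2^-1)%:E :> \bar R)%E.
    by rewrite lee_fin.
  apply: (le_trans _ (leeD2l _ nDE)).
  apply: observation_law_comparison => //.
  - exact: ltW.
  - by rewrite -expR0 ler_expR.
  - by apply: measurableC; exact: mE.
have [] := le_cam_two_point (mE _ K1) (mE _ K2) cov cmp.
  by exists G1.
by exists G2.
Qed.
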